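(* Suppose $p\in\mathbb{C}[z,w]$ has degree $(n,m)$, has no factors involving $z$ alone, and its zero set $Z_p=\{(z,w)\in\mathbb{C}^2:p(z,w)=0\}$ satisfies $$Z_p\subset(\mathbb{D}\times\mathbb{C})\cup\mathbb{T}^2\cup(\mathbb{E}\times\mathbb{C}).$$ Let $n_2$ be the number of zeros of $p(z,0)$ in $\mathbb{D}$ and $n_1=n-n_2$. Then there exists an $(m+n)\times(m+n)$ unitary matrix $U$ such that $p$ is a constant multiple of $$\det\big(U\Delta(z,w)-\Gamma(z,w)\big),$$ where $$\Delta(z,w)=\begin{pmatrix}wI_m&0&0\\0&zI_{n_1}&0\\0&0&I_{n_2}\end{pmatrix},\qquad \Gamma(z,w)=\begin{pmatrix}I_m&0&0\\0&I_{n_1}&0\\0&0&zI_{n_2}\end{pmatrix}.$$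
   Context: $\mathbb{D}=\{|z|<1\}$, $\mathbb{T}=\{|z|=1\}$, $\mathbb{E}=\{|z|>1\}$. Degree $(n,m)$ means degree $n$ in $z$ and degree $m$ in $w$. ''No factors involving $z$ alone'' means no nonconstant factor belonging to $\mathbb{C}[z]$. Zeros are counted with multiplicity. $I_k$ is the $k\times k$ identity matrix. *)

(* Defs.v *)
From HB Require Import structures.
From mathcomp Require Import all_boot all_order all_algebra.
From mathcomp Require Export reals complex.

Set Implicit Arguments.
Unset Strict Implicit.
Unset Printing Implicit Defensive.

Import Order.TTheory GRing.Theory Num.Theory.
Local Open Scope ring_scope.
Local Open Scope complex_scope.

(* C[z, w] is represented as C[z][w], i.e. {poly {poly C}}: the outer variable
   'X is w and the inner variable 'Y = 'X%:P is z.  Hence p.[w0, z0] of polyXY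
   is the value p(z0, w0), p.[0] : {poly C} is p(z, 0), and the image of
   q \in C[z] in C[z, w] is q%:P. *)

Definition has_bidegree (C : nzRingType) (p : {poly {poly C}}) (n m : nat) :=
  sizeY p = n.+1 /\ size p = m.+1.

Definition peval (C : nzRingType) (p : {poly {poly C}}) (z w : C) : C :=
  p.[w, z].

Definition no_factor_in_z_alone (C : nzRingType) (p : {poly {poly C}}) :=
  forall (q : {poly C}) (r : {poly {poly C}}), p = q%:P * r -> (size q <= 1)%N.

(* The root list given by closed_field_poly_normal has multiplicities; it is
   meaningful only for q != 0. *)
Definition nb_zeros_disk (C : numClosedFieldType) (q : {poly C}) : nat :=
  count (fun x : C => `|x| < 1) (sval (closed_field_poly_normal q)).

(* The diagonal matrices are given entrywise, so that their size is m + n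
   itself (n stands for n1 + n2): the first m entries form the first block, the
   next n1 entries the second block and the remaining ones the third block. *)
Definition Delta (C : nzRingType) (m n n1 : nat) : 'M[{poly {poly C}}]_(m + n) :=
  diag_mx (\row_(i < m + n)
    if (i < m)%N then 'X else if (i < m + n1)%N then 'Y else 1).

Definition Gamma (C : nzRingType) (m n n1 : nat) : 'M[{poly {poly C}}]_(m + n) :=
  diag_mx (\row_(i < m + n) if (i < m + n1)%N then 1 else 'Y).

Definition const_poly_mx (C : nzRingType) (k : nat) (U : 'M[C]_k) :
    'M[{poly {poly C}}]_k :=
  map_mx (fun c : C => c%:P%:P) U.

(* Main.v *)
(* A unitary [U] for which [det (U Delta - Gamma)] is proportional to [p] amounts
   to a rational matrix function, unitary on the circle, whose eigenvalues over
   [z] are the roots of [p(z, .)] and which has the right numbers of poles and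
   zeros in the disk.  Suppose first that over every [z] on the circle the roots
   of [p(z, .)] are distinct.  Let [C] be the companion matrix of [p(z, .)] (or
   rather a fraction [F0 G0^-1] of polynomial matrices) and [J] the Gram matrix
   [V^* V] of the Vandermonde matrix of the roots: up to a scalar factor it is a
   trigonometric polynomial, since its entries are power sums, and
   [C^* J C = J].  A matrix Fejer-Riesz factorization [J = A^* A], with
   [det A] free of zeros in the closed disk (found by linear algebra: polynomials
   of the right degree have more coefficients than there are conditions at the
   zeros of [det J] in the disk), turns this into [F^* F = G^* G] on the circle
   for [F = A F0] and [G = A G0], while [det (w G - F) = p det A].
   Pulling Blaschke-Potapov factors out of [F] and [G], one for each zero of
   [p(z, 0)] and of the leading coefficient of [p] in the disk, leaves two outer
   matrices with the same modulus, which differ by a constant unitary matrix.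
   Each factor has a unitary colligation with one state, and composing them
   yields [U].

   In general, [p~(z, w) = z^n w^m conj p(1 / conj z, 1 / conj w)] is a constant
   multiple of [p], which gives the number of zeros of the leading coefficient,
   and [p] is a limit of polynomials with distinct roots, obtained from
   [p(z, x w) + x^m p(z, w / x)] with [0 < x < 1]; these have the same extreme
   coefficients, so the constants stay bounded and the compactness of the
   unitary group gives the theorem. *)
Require Import Defs.
From mathcomp Require Import all_boot all_order all_algebra.
From mathcomp Require Import reals complex.
From mathcomp Require Import separable ring zify.
From mathcomp Require Import boolp classical_sets filter topology normedtype sequences.

Set Implicit Arguments.
Unset Strict Implicit.
Unset Printing Implicit Defensive.

Import Order.TTheory GRing.Theory Num.Theory.
Import numFieldNormedType.Exports.
Local Open Scope ring_scope.
Local Open Scope sesquilinear_scope.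

(** * Polynomials on the unit circle: reversal and Blaschke factors *)

Section Circle.
Variable C : numClosedFieldType.
Implicit Types (f g d : {poly C}) (z w a : C) (s : seq C).

(** The Cayley transform sends the natural numbers to infinitely many points of the circle, without
    any topology on [C]. *)
Definition cayley (k : nat) : C := (1 + k%:R * 'i) / (1 - k%:R * 'i).

Lemma cayley_den (k : nat) : 1 - k%:R * 'i != 0 :> C.
Proof.
have -> : 1 - k%:R * 'i = 1 + 'i * (- k%:R) :> C by rewrite mulrN mulrC.
apply/eqP => /(congr1 (fun x => 'Re x)) /eqP.
by rewrite Re_rect ?rpred1 ?rpredN ?rpred_nat // raddf0 oner_eq0.
Qed.

Lemma norm_cayley k : `|cayley k| = 1.
Proof.
rewrite /cayley normf_div -(norm_conjC (1 - _)) rmorphB rmorphM /= conjCi.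
rewrite rmorph1 rmorph_nat mulrN opprK divff // normr_eq0.
rewrite -conjC_eq0 rmorphD rmorphM /= conjCi rmorph1 rmorph_nat mulrN.
exact: cayley_den.
Qed.

Lemma cayley_inj : injective cayley.
Proof.
move=> k l /eqP; rewrite /cayley eqr_div ?cayley_den // => /eqP E.
have /eqP : 2%:R * 'i * (k%:R - l%:R) = 0 :> C by move: E => /eqP;
  rewrite -subr_eq0 => /eqP <-; ring.
rewrite !mulf_eq0 pnatr_eq0 (negbTE (neq0Ci _)) /= subr_eq0 eqr_nat.
by move/eqP.
Qed.

Lemma poly_circle0 f : (forall z, `|z| = 1 -> f.[z] = 0) -> f = 0.
Proof.
move=> H; apply/eqP/negPn/negP => f0.
pose s := [seq cayley k | k <- iota 0 (size f)].
have : (size s < size f)%N.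
  apply: max_poly_roots => //.
    by apply/allP => _ /mapP[k _ ->]; apply/rootP/H/norm_cayley.
  by rewrite map_inj_uniq ?iota_uniq //; exact: cayley_inj.
by rewrite size_map size_iota ltnn.
Qed.

Lemma eq_poly_circle f g : (forall z, `|z| = 1 -> f.[z] = g.[z]) -> f = g.
Proof.
move=> H; apply/eqP; rewrite -subr_eq0; apply/eqP/poly_circle0 => z z1.
by rewrite !hornerE H // subrr.
Qed.

Lemma eq_poly_circle_generic d f g : d != 0 ->
  (forall z, `|z| = 1 -> d.[z] != 0 -> f.[z] = g.[z]) -> f = g.
Proof.
move=> d0 H; apply: (mulfI d0); apply: eq_poly_circle => z z1.
rewrite !hornerM; have [->|dz] := eqVneq d.[z] 0; first by rewrite !mul0r.
by rewrite H.
Qed.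

Lemma mul_conj_circle z : `|z| = 1 -> z * z^* = 1.
Proof. by move=> z1; rewrite -normCK z1 expr1n. Qed.

Lemma circle_neq0 z : `|z| = 1 -> z != 0.
Proof. by move=> z1; rewrite -normr_eq0 z1 oner_eq0. Qed.

(* [z^n conj f(1 / conj z)], for [f] of degree at most [n]. *)
Definition revp (n : nat) f : {poly C} := \poly_(i < n.+1) (f`_(n - i))^*.

Lemma size_revp n f : (size (revp n f) <= n.+1)%N.
Proof. exact: size_poly. Qed.

Lemma horner_revp_neq0 n f z : (size f <= n.+1)%N -> z != 0 ->
  (revp n f).[z] = z ^+ n * (f.[(z^*)^-1])^*.
Proof.
move=> sf z0; rewrite horner_poly (horner_coef_wide _ sf) rmorph_sum mulr_sumr.
rewrite (reindex_inj rev_ord_inj) /=; apply: eq_bigr => i _.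
have le_in : (i <= n)%N by rewrite -ltnS.
rewrite rmorphM rmorphXn /= subSS subKn // mulrCA; congr (_ * _).
have -> : z ^+ n = z ^+ (n - i) * z ^+ i by rewrite -exprD subnK.
by rewrite fmorphV /= conjCK -mulrA -exprMn divff // expr1n mulr1.
Qed.

Lemma horner_revp n f z : (size f <= n.+1)%N -> `|z| = 1 ->
  (revp n f).[z] = z ^+ n * (f.[z])^*.
Proof.
move=> sf z1; rewrite horner_revp_neq0 ?circle_neq0 //.
have zc0 : z^* != 0 by rewrite conjC_eq0 circle_neq0.
by rewrite (_ : _^-1 = z) //; apply: (mulIf zc0); rewrite mulVf // mul_conj_circle.
Qed.

Lemma revpE n f g : (size f <= n.+1)%N -> 
  (forall z, `|z| = 1 -> g.[z] = z ^+ n * (f.[z])^*) -> revp n f = g.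
Proof.
by move=> sf H; apply: eq_poly_circle => z z1; rewrite horner_revp // H.
Qed.

Lemma revpK n f : (size f <= n.+1)%N -> revp n (revp n f) = f.
Proof.
move=> sf; apply: eq_poly_circle => z z1.
rewrite !horner_revp ?size_revp // rmorphM rmorphXn /= conjCK mulrA -exprMn.
by rewrite mul_conj_circle // expr1n mul1r.
Qed.

(** For [s] in the disk, the quotient of these two products is a finite Blaschke product. *)
Definition blaschke_num s := \prod_(a <- s) ('X - a%:P) : {poly C}.
Definition blaschke_den s := \prod_(a <- s) (1 - a^* *: 'X) : {poly C}.

Lemma horner_blaschke_num s z : (blaschke_num s).[z] = \prod_(a <- s) (z - a).
Proof. by rewrite horner_prod; apply: eq_bigr => a _; rewrite !hornerE. Qed.

Lemma horner_blaschke_den s z : (blaschke_den s).[z] = \prod_(a <- s) (1 - a^* * z).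
Proof. by rewrite horner_prod; apply: eq_bigr => a _; rewrite !hornerE. Qed.

Lemma blaschke_den_factor_neq0 a z : `|a| < 1 -> `|z| <= 1 -> 1 - a^* * z != 0.
Proof.
move=> a1 z1; rewrite subr_eq0; apply/negP => /eqP E.
have := ltxx (1 : C); rewrite {1}[1](_ : _ = `|a^* * z|); last first.
  by rewrite -E normr1.
rewrite normrM norm_conjC (le_lt_trans _ a1) //.
by rewrite ler_piMr.
Qed.

Lemma horner_blaschke_den_neq0 s z : all (fun a => `|a| < 1) s -> `|z| <= 1 ->
  (blaschke_den s).[z] != 0.
Proof.
move=> /allP s1 z1; rewrite horner_blaschke_den prodf_seq_neq0; apply/allP => a /s1 a1.
by rewrite blaschke_den_factor_neq0.
Qed.

Lemma blaschke_num_neq0 s : blaschke_num s != 0.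
Proof. by rewrite monic_neq0 // monic_prod_XsubC. Qed.

Definition disk_roots f : seq C :=
  [seq a <- sval (closed_field_poly_normal f) | `|a| < 1].

Lemma disk_roots_disk f : all (fun a => `|a| < 1) (disk_roots f).
Proof. by apply/allP => a; rewrite mem_filter => /andP[]. Qed.

(** Reversal reflects roots in the circle: a root [a] in the disk turns [z - a] into [1 - conj a z],
    while a root outside becomes a root in the disk. *)
Lemma revp_factor n f : f != 0 -> (size f <= n.+1)%N ->
    (forall z, `|z| = 1 -> f.[z] != 0) ->
  let s := disk_roots f in
  exists s' (k : C), [/\ k != 0, all (fun a => `|a| < 1) s', (size s' + size s = n)%N &
    revp n f = k *: (blaschke_num s' * blaschke_den s)].
Proof.
move=> f0 sf fT /=; rewrite /disk_roots; set r := sval _; set s := [seq a <- r | _].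
have fE : f = lead_coef f *: \prod_(a <- r) ('X - a%:P).
  exact: (svalP (closed_field_poly_normal f)).
have l0 : lead_coef f != 0 by rewrite lead_coef_eq0.
have szr : (size r <= n)%N.
  by move: sf; rewrite fE size_scale // size_prod_XsubC ltnS.
pose t := [seq a <- r | ~~ (`|a| < 1)].
have tE a : a \in t -> 1 < `|a|.
  rewrite mem_filter -real_leNgt ?ger0_real // => /andP[a1 ar].
  rewrite lt_neqAle a1 andbT eq_sym; apply/negP => /eqP /fT; rewrite fE hornerZ.
  rewrite horner_prod (big_rem a) //= hornerXsubC subrr mul0r mulr0.
  by rewrite eqxx.
have szst : (size s + size t = size r)%N by rewrite !size_filter count_predC.
(* Each degree that [f] lacks below [n] gives a zero of the reversal at 0; the other zeros in the
   disk are the reflections of the roots outside. *)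
exists (nseq (n - size r) 0 ++ [seq (a^*)^-1 | a <- t]).
exists ((lead_coef f)^* * \prod_(a <- t) (- a^*)); split.
- rewrite mulf_neq0 ?conjC_eq0 // prodf_seq_neq0; apply/allP => a /tE a1 /=.
  by rewrite oppr_eq0 conjC_eq0 -normr_gt0 (lt_trans ltr01).
- rewrite all_cat all_nseq normr0 ltr01 orbT /=.
  apply/allP => _ /mapP[a /tE a1 ->].
  by rewrite normfV norm_conjC invf_lt1 // (lt_trans ltr01).
- by rewrite size_cat size_nseq size_map -addnA [(size t + _)%N]addnC szst subnK.
apply: revpE => // z z1.
rewrite {2}fE !hornerZ hornerM horner_blaschke_num horner_blaschke_den horner_prod.
rewrite rmorphM /= [RHS]mulrCA -[LHS]mulrA; congr (_ * _).
rewrite rmorph_prod /= big_cat /= big_nseq subr0 iter_mulr_1 big_map.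
have -> : z ^+ n = z ^+ (n - size r) * \prod_(a <- r) z.
  by rewrite big_const_seq count_predT iter_mulr_1 -exprD subnK.
have -> : z ^+ (n - size r) * \prod_(a <- r) z * \prod_(a <- r) (('X - a%:P).[z])^* =
    z ^+ (n - size r) * \prod_(a <- r) (1 - a^* * z).
  rewrite -mulrA -big_split; congr (_ * _); apply: eq_bigr => a _ /=.
  by rewrite hornerXsubC rmorphB mulrBr mul_conj_circle // mulrC.
rewrite mulrCA -!mulrA; congr (_ * _).
have -> : \prod_(a <- r) (1 - a^* * z) =
    \prod_(a <- t) (1 - a^* * z) * \prod_(a <- s) (1 - a^* * z).
  by rewrite (bigID (fun a => `|a| < 1)) /= [LHS]mulrC !big_filter.
rewrite mulrA.
congr (_ * _); rewrite -big_split /= !big_seq; apply: eq_bigr => a /tE a1.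
have a0 : a^* != 0 by rewrite conjC_eq0 -normr_gt0 (lt_trans ltr01).
by rewrite mulrBl !mulrN mulVf // opprK addrC [z * _]mulrC.
Qed.

End Circle.

(** * A Liouville theorem for fractions of polynomials *)

Section Liouville.
Variable C : numClosedFieldType.
Implicit Types (f g d P Q : {poly C}) (z w a : C).

Lemma coprimep_no_common_root f g : f != 0 ->
  (forall z, root f z -> ~~ root g z) -> coprimep f g.
Proof.
move=> f0 H; rewrite /coprimep; apply/negPn/negP => /closed_rootP[z].
by rewrite root_gcd => /andP[/H /negP].
Qed.

(** Multiplied by [z^N], the relation becomes [P * revp N d' = d * revp N Q]. The roots of [d] lie
    outside the closed disk and those of [revp N d'] in the open disk, so these two are coprime. *)
Lemma zero_free_dvdp P Q d d' :
    (forall z, `|z| <= 1 -> d.[z] != 0) -> (forall z, `|z| <= 1 -> d'.[z] != 0) ->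
    (forall z, `|z| = 1 -> P.[z] * (d'.[z])^* = d.[z] * (Q.[z])^*) ->
  d %| P.
Proof.
move=> dD d'D H; pose N := maxn (size Q) (size d').
have sQ : (size Q <= N.+1)%N by rewrite leqW // leq_maxl.
have sd : (size d' <= N.+1)%N by rewrite leqW // leq_maxr.
have E : P * revp N d' = d * revp N Q.
  apply: eq_poly_circle => z z1; rewrite !hornerM !horner_revp //.
  by rewrite mulrCA H // mulrCA.
have d0 : d != 0.
  by apply: contraTneq isT => d0; have := dD 0;
    rewrite d0 horner0 normr0 ler01 eqxx => /(_ isT).
have cop : coprimep d (revp N d').
  apply: coprimep_no_common_root => // z rz.
  have z1 : 1 < `|z|.
    by rewrite real_ltNge ?ger0_real //; apply/negP => /dD; rewrite -/(root d z) rz.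
  have z0 : z != 0 by rewrite -normr_gt0 (lt_trans ltr01).
  rewrite /root horner_revp_neq0 // mulf_neq0 ?expf_neq0 // conjC_eq0 d'D //.
  by rewrite normfV norm_conjC invf_le1 ?ltW // (lt_trans ltr01).
by rewrite -(Gauss_dvdpl _ cop) E dvdp_mulr.
Qed.

(** Both [P / d] and [Q / d'] are polynomials by [zero_free_dvdp], and they are conjugate to each
    other on the circle, which forces them to be constant. *)
Lemma zero_free_const P Q d d' :
    (forall z, `|z| <= 1 -> d.[z] != 0) -> (forall z, `|z| <= 1 -> d'.[z] != 0) ->
    (forall z, `|z| = 1 -> P.[z] * (d'.[z])^* = d.[z] * (Q.[z])^*) ->
  exists c, P = c *: d.
Proof.
move=> dD d'D H; have /dvdpP[h Ph] := zero_free_dvdp dD d'D H.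
have /dvdpP[g Qg] : d' %| Q.
  apply: (zero_free_dvdp (Q := P) d'D dD) => z z1.
  have := congr1 Num.conj (H z z1); rewrite !rmorphM /= !conjCK => E.
  by rewrite mulrC -E mulrC.
(* The right side has degree at most [size g], which leaves degree 0 for [h]. *)
have hg : h * 'X^(size g) = revp (size g) g.
  apply: eq_poly_circle => z z1; have le1 : `|z| <= 1 by rewrite z1.
  rewrite hornerM hornerXn horner_revp // mulrC; congr (_ * _).
  have := H z z1; rewrite Ph Qg !hornerM rmorphM /= => E.
  apply: (mulIf (dD z le1)); apply: (mulIf (_ : (d'.[z])^* != 0)).
    by rewrite conjC_eq0 d'D.
  by rewrite E; ring.
have sh : (size h <= 1)%N.
  have [->|h0] := eqVneq h 0; first by rewrite size_poly0.
  have := size_revp (size g) g; rewrite -hg size_mulXn // -addn1.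
  by rewrite leq_add2l.
by exists h`_0; rewrite Ph {1}(size1_polyC sh) mul_polyC.
Qed.

End Liouville.

(** * Extracting a zero of the determinant of a polynomial matrix *)

Section Peel.
Variable C : numClosedFieldType.

Lemma det_rank1 (R : comNzRingType) m (u : 'cV[R]_m) (v : 'rV[R]_m) :
  \det (1%:M + u *m v) = 1 + (v *m u) 0 0.
Proof.
have E1 : block_mx 1%:M (- v) u 1%:M =
    block_mx 1%:M 0 u 1%:M *m block_mx 1%:M (- v) 0 (1%:M + u *m v).
  by rewrite mulmx_block !mul1mx !mul0mx !mulmx1 !addr0 mulmxN addrC addrK.
have E2 : block_mx 1%:M (- v) u 1%:M =
    block_mx (1%:M + v *m u) (- v) 0 1%:M *m block_mx 1%:M 0 u (1%:M : 'M[R]_m).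
  by rewrite mulmx_block !mul1mx !mul0mx !mulmx1 !mulmx0 !add0r mulNmx addrK.
have := congr1 (fun M => \det M) E1; rewrite E2 !det_mulmx !det_ublock !det_lblock.
by rewrite !det1 !mul1r !mulr1 det_mx11 !mxE => ->.
Qed.

Lemma dotmx_gt0 n (v : 'rV[C]_n) : v != 0 -> 0 < dotmx v v.
Proof.
move=> /rV0Pn[i vi]; rewrite dotmxE mxE (bigD1 i) //= !mxE -normCK.
rewrite ltr_wpDr ?exprn_gt0 ?normr_gt0 // sumr_ge0 // => j _.
by rewrite !mxE -normCK exprn_ge0.
Qed.

Lemma singular_unit_vector m (M : 'M[C]_m) : \det M = 0 ->
  exists2 u : 'cV[C]_m, u^t* *m u = 1%:M & u^t* *m M = 0.
Proof.
move/eqP/det0P => [v v0 vM].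
have n0 := dotmx_gt0 v0.
exists (((sqrtC (dotmx v v))^-1 *: v)^t*); rewrite trmxCK; last first.
  by rewrite -scalemxAl vM scaler0.
rewrite linearZ /= map_mxZ -scalemxAl -scalemxAr scalerA.
rewrite [_ *m _]mx11_scalar -dotmxE scale_scalar_mx; congr (_%:M).
rewrite /= geC0_conj ?invr_ge0 ?sqrtC_ge0 ?ltW // -invfM -expr2 sqrtCK.
by rewrite mulVf // gt_eqF.
Qed.

(** With [u^*] in the left kernel of [F(a)], the row [u^* F] is divisible by [z - a]. Hence
    [F = (1 - P + (z - a) P) N] for the projection [P = u u^*], and the first factor has determinant
    [z - a]. *)
Lemma left_factor m (F : 'M[{poly C}]_m) (a : C) (f : {poly C}) :
    \det F = ('X - a%:P) * f ->
  exists (u : 'cV[C]_m) (N : 'M[{poly C}]_m),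
  [/\ u^t* *m u = 1%:M, \det N = f
    & F = N + ('X - a%:P - 1) *: (map_mx polyC u *m (map_mx polyC (u^t*) *m N))].
Proof.
move=> dF; have /singular_unit_vector[u uu uF] : \det (map_mx (horner_eval a) F) = 0.
  by rewrite det_map_mx dF /= /horner_eval !hornerE subrr mul0r.
pose us := map_mx polyC (u^t*); pose pu := map_mx polyC u.
have usu : us *m pu = 1%:M by rewrite -map_mxM uu map_mx1.
pose r : 'rV[{poly C}]_m := map_mx (fun q => q %/ ('X - a%:P)) (us *m F).
set l := 'X - a%:P in dF *.
have usF : us *m F = l *: r.
  apply/matrixP => i j; rewrite !mxE [RHS]mulrC divpK // dvdp_XsubCl.
  have /matrixP/(_ i j) := uF; rewrite !mxE => E; apply/rootP.
  rewrite horner_sum -[RHS]E; apply: eq_bigr => k _.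
  by rewrite !mxE /horner_eval !hornerE.
pose N := F - (l - 1) *: (pu *m r).
have usN : us *m N = r.
  by rewrite mulmxBr usF -scalemxAr mulmxA usu mul1mx -scalerBl subKr scale1r.
have FN : F = N + (l - 1) *: (pu *m r) by rewrite subrK.
exists u, N; split => //; last by rewrite -/us -/pu usN.
have : \det F = l * \det N.
  rewrite {1}FN -usN mulmxA scalemxAl -[X in \det (X + _)]mul1mx -mulmxDl det_mulmx.
  rewrite scalemxAl det_rank1 -scalemxAr usu !mxE eqxx mulr1.
  by rewrite addrC subrK.
by rewrite dF => /mulfI -> //; rewrite polyXsubC_eq0.
Qed.

(** In terms of [P = u u^*] and [b(z) = (z - a) / (1 - conj a z)], this reads
    [F = (1 - P + b P) F']: for [|a| < 1] the factor taken out is unitary on the circle. The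
    quotient [r] of [u^* F'] by [1 - conj a z] keeps everything polynomial. *)
Lemma peel m (F : 'M[{poly C}]_m) (a : C) (f : {poly C}) :
    \det F = ('X - a%:P) * f ->
  exists (u : 'cV[C]_m) (r : 'rV[{poly C}]_m) (F' : 'M[{poly C}]_m),
  [/\ u^t* *m u = 1%:M, \det F' = (1 - a^* *: 'X) * f,
      map_mx polyC (u^t*) *m F' = (1 - a^* *: 'X) *: r
    & F = F' + (('X - a%:P) - (1 - a^* *: 'X)) *: (map_mx polyC u *m r)].
Proof.
move=> /left_factor[u [N [uu dN ->]]].
set us := map_mx polyC (u^t*); set pu := map_mx polyC u; set q := 1 - _.
have usu : us *m pu = 1%:M by rewrite -map_mxM uu map_mx1.
exists u, (us *m N), (N + (q - 1) *: (pu *m (us *m N))); split => //.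
- rewrite mulmxA scalemxAl -[X in \det (X + _)]mul1mx -mulmxDl det_mulmx.
  by rewrite scalemxAl det_rank1 -scalemxAr usu !mxE eqxx mulr1 addrC subrK dN.
- rewrite -/us mulmxDr -scalemxAr (mulmxA us) usu mul1mx -[X in X + _]scale1r -scalerDl.
  by rewrite addrC subrK.
- rewrite -/us -/pu; move: (pu *m _) => V.
  by apply/matrixP => i j; rewrite !mxE; ring.
Qed.

End Peel.

(** * Unitary colligations and their composition *)

Section Colligation.
Variable C : numClosedFieldType.
Implicit Types (a z w : C) (l : seq bool).

Lemma norm_det_unitary n (U : 'M[C]_n) : U \is unitarymx -> `|\det U| = 1.
Proof.
move=> /unitarymxP /(congr1 determinant); rewrite det_mulmx det_map_mx det_tr det1.
by rewrite -normCK => /eqP; rewrite sqrp_eq1 // => /eqP.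
Qed.

Definition defect a : C := sqrtC (1 - `|a| ^+ 2).

Lemma defect_sqr a : defect a * defect a = 1 - a * a^*.
Proof. by rewrite -expr2 sqrtCK normCK. Qed.

Lemma defect_conj a : `|a| < 1 -> (defect a)^* = defect a.
Proof.
move=> a1; rewrite geC0_conj // sqrtC_ge0 subr_ge0 expr_le1 // ltW //.
Qed.

(* Unitary colligation, the state coming first, of the Blaschke-Potapov factor
   [1 - u u^* + b u u^*], where [b z = (z - a) / (1 - conj a z)]. *)
Definition bp_colligation q a (u : 'cV[C]_q) : 'M[C]_(1 + q) :=
  block_mx (a^*)%:M (defect a *: u^t* ) (defect a *: u)
    (1%:M - (1 + a) *: (u *m u^t* )).

Lemma tr_bp_colligation q a (u : 'cV[C]_q) : `|a| < 1 ->
  (bp_colligation a u)^t* = bp_colligation a^* u.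
Proof.
move=> a1; rewrite /bp_colligation tr_block_mx map_block_mx.
rewrite tr_scalar_mx map_scalar_mx /= conjCK.
have -> : defect a^* = defect a by rewrite /defect norm_conjC.
congr block_mx; apply/matrixP => i j; rewrite !mxE.
- by rewrite rmorphM /= defect_conj.
- by rewrite rmorphM /= defect_conj // conjCK.
- rewrite rmorphB rmorphM rmorphD rmorph1 rmorph_nat rmorph_sum /=.
  rewrite [j == i]eq_sym; congr (_ - _ * _); apply: eq_bigr => k _.
  by rewrite !mxE rmorphM /= conjCK mulrC.
Qed.

Lemma bp_colligation_unitary q a (u : 'cV[C]_q) : `|a| < 1 ->
  u^t* *m u = 1%:M -> bp_colligation a u \is unitarymx.
Proof.
move=> a1 uu; apply/unitarymxP; rewrite tr_bp_colligation //.
have E : defect a^* = defect a by rewrite /defect norm_conjC.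
rewrite /bp_colligation E conjCK mulmx_block [RHS]scalar_mx_block.
set P := u *m u^t*.
have PP : P *m P = P by rewrite /P mulmxA -[_ *m u]mulmxA uu mulmx1.
have uP : u^t* *m P = u^t* by rewrite mulmxA uu mul1mx.
have Pu : P *m u = u by rewrite -mulmxA uu mulmx1.
have ds := defect_sqr a.
rewrite -!scalemxAl -!scalemxAr !scalerA uu ds.
rewrite !mul_scalar_mx !mul_mx_scalar !mulmxBl !mulmxBr !mul1mx !mulmx1.
rewrite -!scalemxAl -!scalemxAr PP uP Pu -/P.
by congr block_mx; apply/matrixP => i j; rewrite !mxE; ring: ds.
Qed.

(** The state leaves as [defect a *: r] and comes back multiplied by [z]; eliminating it leaves the
    Blaschke-Potapov factor acting on [W]. *)
Lemma bp_colligation_apply q m a z (u : 'cV[C]_q) (W : 'M_(q, m)) (r : 'rV_m) :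
    u^t* *m u = 1%:M -> u^t* *m W = (1 - a^* * z) *: r ->
  bp_colligation a u *m col_mx (z *: (defect a *: r)) W =
    col_mx (defect a *: r) (W + ((z - a) - (1 - a^* * z)) *: (u *m r)).
Proof.
move=> uu uW; rewrite mul_block_col mul_scalar_mx -!scalemxAl uW.
rewrite mulmxBl mul1mx -!scalemxAl -mulmxA uW -!scalemxAr !scalerA.
have ds := defect_sqr a.
by congr col_mx; apply/matrixP => i j; rewrite !mxE; ring: ds.
Qed.

(* A state labelled [true] carries [z] in Delta, one labelled [false] carries [z]
   in Gamma.  Unlike in [Delta], the states precede the [m] coordinates carrying
   [w], so that adding a state yields a size convertible to [1 + _]. *)
Definition delta_diag l m z w : 'rV[C]_(size l + m) :=
  \row_i if (i < size l)%N then (if nth false l i then z else 1) else w.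
Definition gamma_diag l m z w : 'rV[C]_(size l + m) :=
  \row_i if (i < size l)%N then (if nth false l i then 1 else z) else w.

Lemma delta_diag_cons b l m z w :
  delta_diag (b :: l) m z w = row_mx (if b then z else 1)%:M (delta_diag l m z w)
    :> 'rV_(1 + _).
Proof.
apply/rowP => i; rewrite !mxE; case: (@splitP 1 (size l + m) i) => j E;
  rewrite ?mxE E ?(ord1 j) //.
Qed.

Lemma gamma_diag_cons b l m z w :
  gamma_diag (b :: l) m z w = row_mx (if b then 1 else z)%:M (gamma_diag l m z w)
    :> 'rV_(1 + _).
Proof.
apply/rowP => i; rewrite !mxE; case: (@splitP 1 (size l + m) i) => j E;
  rewrite ?mxE E ?(ord1 j) //.
Qed.

Lemma delta_diag_split l m z w : exists D, forall w, delta_diag l m z w =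
  row_mx D (const_mx w).
Proof.
exists (\row_i if nth false l i then z else 1) => w'; apply/rowP => i.
by rewrite !mxE; case: splitP => j E; rewrite !mxE ?E.
Qed.

Lemma gamma_diag_split l m z w : exists D, forall w, gamma_diag l m z w =
  row_mx D (const_mx w).
Proof.
exists (\row_i if nth false l i then 1 else z) => w'; apply/rowP => i.
by rewrite !mxE; case: splitP => j E; rewrite !mxE ?E.
Qed.

Lemma diag_row_mx_scalar k m (D : 'rV[C]_k) w :
  diag_mx (row_mx D (const_mx w : 'rV_m)) = block_mx (diag_mx D) 0 0 w%:M.
Proof. by rewrite diag_mx_row diag_const_mx. Qed.

Lemma delta_diag_cons_block b l m z w :
  diag_mx (delta_diag (b :: l) m z w) =
  block_mx (if b then z else 1)%:M 0 0 (diag_mx (delta_diag l m z w))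
    :> 'M_(1 + (size l + m)).
Proof.
apply: (etrans (congr1 (@diag_mx _ (1 + (size l + m))) (delta_diag_cons b l m z w))).
rewrite diag_mx_row; congr block_mx.
by apply/matrixP => i j; rewrite !mxE (ord1 i) (ord1 j).
Qed.

Lemma gamma_diag_cons_block b l m z w :
  diag_mx (gamma_diag (b :: l) m z w) =
  block_mx (if b then 1 else z)%:M 0 0 (diag_mx (gamma_diag l m z w))
    :> 'M_(1 + (size l + m)).
Proof.
apply: (etrans (congr1 (@diag_mx _ (1 + (size l + m))) (gamma_diag_cons b l m z w))).
rewrite diag_mx_row; congr block_mx.
by apply/matrixP => i j; rewrite !mxE (ord1 i) (ord1 j).
Qed.

Lemma col_mx_consA k m p (y : 'rV[C]_p) (Y : 'M_(k, p)) (F : 'M_(m, p)) :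
  col_mx (col_mx y Y : 'M_(1 + k, p)) F = col_mx y (col_mx Y F) :> 'M_(1 + (k + m), p).
Proof.
rewrite [RHS]col_mxA; exact/esym/castmx_id.
Qed.

(** The transfer function of [U] takes [F(z)] to [G(z)]. It is expressed through the states [Y]
    rather than through an inverse, which might not exist at [z]. *)
Definition realizes l m (U : 'M[C]_(size l + m)) (F G : C -> 'M[C]_m) z :=
  exists Y : 'M_(size l, m),
    U *m (diag_mx (delta_diag l m z 1) *m col_mx Y (F z)) =
    diag_mx (gamma_diag l m z 1) *m col_mx Y (G z).

Lemma realizes_cons b l m (U : 'M[C]_(1 + (size l + m))) F G z
    (y : 'rV_m) (Y : 'M_(size l, m)) :
    U *m (block_mx (if b then z else 1)%:M 0 0 (diag_mx (delta_diag l m z 1)) *m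
      col_mx y (col_mx Y (F z))) =
    block_mx (if b then 1 else z)%:M 0 0 (diag_mx (gamma_diag l m z 1)) *m
      col_mx y (col_mx Y (G z)) ->
  @realizes (b :: l) m U F G z.
Proof.
by rewrite -delta_diag_cons_block -gamma_diag_cons_block -!col_mx_consA => H;
  exists (col_mx y Y).
Qed.

(* The coefficient of [w^m] in [det (U Delta - Gamma)]. *)
Definition charfun l m (U : 'M[C]_(size l + m)) z : C :=
  \det (U *m diag_mx (delta_diag l m z 1) - diag_mx (gamma_diag l m z 0)).

Lemma charfun_cons b l m (U : 'M[C]_(1 + (size l + m))) z :
  charfun (U : 'M_(size (b :: l) + m)) z =
  \det (U *m block_mx (if b then z else 1)%:M 0 0 (diag_mx (delta_diag l m z 1)) -
    block_mx (if b then 1 else z)%:M 0 0 (diag_mx (gamma_diag l m z 0))).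
Proof. by rewrite -delta_diag_cons_block -gamma_diag_cons_block. Qed.

(* [(U Delta - Gamma) [1, Y; 0, G] = (U Delta' - Gamma') [1, 0; 0, w G - F]], where
   [Delta'] and [Gamma'] have [w] replaced by 1 and [1] by 0 in the last block. *)
Lemma realizes_det l m (U : 'M[C]_(size l + m)) F G z w :
    realizes U F G z ->
  \det (U *m diag_mx (delta_diag l m z w) - diag_mx (gamma_diag l m z 1)) * \det (G z) =
  \det (w *: G z - F z) * charfun U z.
Proof.
rewrite /charfun; have [D DE] := delta_diag_split l m z 1;
  have [E EE] := gamma_diag_split l m z 1.
rewrite /realizes !DE !EE !diag_row_mx_scalar => -[Y].
rewrite !mul_block_col !mul0mx !mul1mx !addr0 !add0r => rel.
pose L := block_mx 1%:M Y 0 (G z);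
  pose M : 'M_(size l + m) := block_mx 1%:M 0 0 (w *: G z - F z).
have -> : \det (G z) = \det L by rewrite det_ublock det1 mul1r.
have -> : \det (w *: G z - F z) = \det M by rewrite det_ublock det1 mul1r.
rewrite [RHS]mulrC -!det_mulmx; congr (\det _).
rewrite !mulmxBl -!mulmxA !mulmx_block !mulmx1 !mulmx0 !mul0mx !mul1mx !addr0 !add0r.
rewrite !mul_scalar_mx scale0r !block_mxEh !mul_mx_row.
have -> : col_mx (diag_mx D *m Y) (w *: G z) =
    col_mx (diag_mx D *m Y) (F z) + col_mx 0 (w *: G z - F z).
  by rewrite add_col_mx addr0 addrC subrK.
rewrite mulmxDr rel !opp_row_mx !add_row_mx; congr row_mx.
by rewrite col_mx0 subr0 addrAC subrr add0r.
Qed.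

(** Places the vector of a new factor in the last [m] coordinates, so that the factor leaves the [k]
    existing states alone. *)
Definition pad k m (u : 'cV[C]_m) : 'cV[C]_(k + m) := col_mx 0 u.

Lemma pad_unit k m (u : 'cV[C]_m) : u^t* *m u = 1%:M ->
  (pad k u)^t* *m pad k u = 1%:M.
Proof.
by move=> uu; rewrite tr_col_mx map_row_mx mul_row_col mulmx0 add0r.
Qed.

Lemma pad_mul k m p (u : 'cV[C]_m) (Y : 'M_(k, p)) (F : 'M_(m, p)) :
  (pad k u)^t* *m col_mx Y F = u^t* *m F.
Proof. by rewrite tr_col_mx map_row_mx mul_row_col trmx0 map_mx0 mul0mx add0r. Qed.

Definition bordered q (U : 'M[C]_q) : 'M_(1 + q) := block_mx 1%:M 0 0 U.

Lemma bordered_unitary q (U : 'M[C]_q) : U \is unitarymx -> bordered U \is unitarymx.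
Proof.
move=> /unitarymxP UU; apply/unitarymxP.
rewrite tr_block_mx map_block_mx mulmx_block !trmx0 !map_mx0 !mulmx0 !mul0mx.
by rewrite !add0r addr0 UU trmx1 map_mx1 mulmx1 -scalar_mx_block.
Qed.

Lemma bdiag_mul_col p k q (c : C) (D : 'M_(k, p)) (y : 'rV_q) (X : 'M_(p, q)) :
  block_mx c%:M 0 0 D *m col_mx y X = col_mx (c *: y) (D *m X).
Proof. by rewrite mul_block_col !mul0mx addr0 add0r mul_scalar_mx. Qed.

Lemma bdiag_scalar_mul_col p k m q (c : C) (D : 'M_(k, p)) (Y : 'M_(p,
  q)) (X : 'M_(m, q)) :
  block_mx D 0 0 c%:M *m col_mx Y X = col_mx (D *m Y) (c *: X).
Proof. by rewrite mul_block_col !mul0mx addr0 add0r mul_scalar_mx. Qed.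

Section Step.
Variables (l : seq bool) (m : nat) (U : 'M[C]_(size l + m)) (a : C) (u : 'cV[C]_m).
Hypotheses (a1 : `|a| < 1) (uu : u^t* *m u = 1%:M).
Let V := bp_colligation a (pad (size l) u).
Let V_unitary : V \is unitarymx.
Proof. exact/bp_colligation_unitary/pad_unit. Qed.
Let V_tr : V^t* = bp_colligation a^* (pad (size l) u).
Proof. exact: tr_bp_colligation. Qed.

(** [G] is a Blaschke-Potapov factor times [G'], so the factor is composed at the output. The new
    state takes its [z] on the input side, in Delta. *)
Lemma realizes_zero F G G' z r :
    u^t* *m G' z = (1 - a^* * z) *: r ->
    G z = G' z + ((z - a) - (1 - a^* * z)) *: (u *m r) ->
  realizes U F G' z -> @realizes (true :: l) m (V *m bordered U) F G z.
Proof.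
move=> uG' GE [Y rel]; apply: (realizes_cons (y := defect a *: r) (Y := Y)).
rewrite -mulmxA !bdiag_mul_col !scale1r rel.
have [E EE] := gamma_diag_split l m z 1; rewrite !EE !diag_row_mx_scalar.
rewrite !bdiag_scalar_mul_col !scale1r.
rewrite bp_colligation_apply ?pad_unit //; last by rewrite pad_mul.
congr col_mx; rewrite mul_col_mx mul0mx scale_col_mx scaler0 add_col_mx addr0.
by rewrite GE.
Qed.

(** [F] is the factor times [F'], so the inverse factor is composed at the input. It is realized by
    [V^*], with input and output exchanged, which moves the [z] of the new state to Gamma. *)
Lemma realizes_pole F F' G z r :
    u^t* *m F' z = (1 - a^* * z) *: r ->
    F z = F' z + ((z - a) - (1 - a^* * z)) *: (u *m r) ->
  realizes U F' G z -> @realizes (false :: l) m (bordered U *m V^t* ) F G z.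
Proof.
move=> uF' FE [Y rel]; apply: (realizes_cons (y := defect a *: r) (Y := Y)).
rewrite !bdiag_mul_col scale1r -rel.
have [D DE] := delta_diag_split l m z 1; rewrite !DE !diag_row_mx_scalar.
rewrite !bdiag_scalar_mul_col !scale1r.
have -> : col_mx (defect a *: r) (col_mx (diag_mx D *m Y) (F z)) =
    V *m col_mx (z *: (defect a *: r)) (col_mx (diag_mx D *m Y) (F' z)).
  rewrite bp_colligation_apply ?pad_unit //; last by rewrite pad_mul.
  congr col_mx; rewrite mul_col_mx mul0mx scale_col_mx scaler0 add_col_mx addr0.
  by rewrite FE.
rewrite -mulmxA (mulmxA (V^t*)) -invmx_unitary // mulVmx ?unitarymx_unit // mul1mx.
by rewrite bdiag_mul_col scale1r.
Qed.

(** Writing Gamma as [V V^* Gamma] pulls [V] out on the left. With [w] set to 0, Gamma kills the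
    coordinates where the padded vector lives, so the rest is block triangular. *)
Lemma charfun_zero z :
  charfun (V *m bordered U : 'M_(size (true :: l) + m)) z =
  \det V * (z - a) * charfun U z.
Proof.
rewrite charfun_cons /= -mulrA.
have -> : V *m bordered U *m block_mx z%:M 0 0 (diag_mx (delta_diag l m z 1)) -
    block_mx 1%:M 0 0 (diag_mx (gamma_diag l m z 0)) =
    V *m block_mx (z - a)%:M 0 (- (defect a *: pad (size l) u))
      (U *m diag_mx (delta_diag l m z 1) - diag_mx (gamma_diag l m z 0)).
  have [E EE] := gamma_diag_split l m z 0; rewrite !EE !diag_row_mx_scalar.
  have padE : (pad (size l) u)^t* *m block_mx (diag_mx E) 0 0 0%:M = 0.
    by rewrite block_mxEv pad_mul mul_mx_row !mulmx0 mul_mx_scalar scale0r row_mx0.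
  set G0 := block_mx (diag_mx E) 0 0 _ in padE *.
  rewrite -[X in _ - X]mul1mx -(unitarymxP V_unitary) -!mulmxA -mulmxBr.
  congr (_ *m _); rewrite V_tr !mulmx_block !mul0mx !mulmx0 !mulmx1 !mul1mx.
  rewrite !addr0 !add0r mulmxBl mul1mx -!scalemxAl padE -mulmxA padE mulmx0 !scaler0
    subr0.
  rewrite opp_block_mx add_block_mx !subr0 sub0r conjCK -raddfB /=.
  by rewrite /defect norm_conjC.
by rewrite det_mulmx det_lblock det_scalar1.
Qed.

(** Here [V^*] comes out on the right: with [w] set to 1, Delta fixes the padded vector and commutes
    with [V], and again Gamma kills that vector. *)
Lemma charfun_pole z :
  charfun (bordered U *m V^t* : 'M_(size (false :: l) + m)) z =
  \det (V^t* ) * (1 - a^* * z) * charfun U z.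
Proof.
rewrite charfun_cons /= -mulrA [RHS]mulrC.
have -> : bordered U *m V^t* *m block_mx 1%:M 0 0 (diag_mx (delta_diag l m z 1)) -
    block_mx z%:M 0 0 (diag_mx (gamma_diag l m z 0)) =
    block_mx (1 - a^* * z)%:M (- (z *: (defect a *: (pad (size l) u)^t* ))) 0
      (U *m diag_mx (delta_diag l m z 1) - diag_mx (gamma_diag l m z 0)) *m V^t*.
  have [D DE] := delta_diag_split l m z 1; have [E EE] := gamma_diag_split l m z 0.
  rewrite !DE !EE !diag_row_mx_scalar.
  have padE : block_mx (diag_mx E) 0 0 0%:M *m pad (size l) u = 0.
    by rewrite bdiag_scalar_mul_col mulmx0 scale0r col_mx0.
  have padD : block_mx (diag_mx D) 0 0 1%:M *m pad (size l) u = pad (size l) u.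
    by rewrite mul_block_col !mulmx0 mul0mx mul1mx addr0 add0r.
  have Dpad : (pad (size l) u)^t* *m block_mx (diag_mx D) 0 0 1%:M =
    (pad (size l) u)^t*.
    rewrite block_mxEv pad_mul mul_mx_row mulmx0 mulmx1.
    by rewrite tr_col_mx map_row_mx trmx0 map_mx0.
  set G0 := block_mx (diag_mx E) 0 0 _ in padE *.
  set D0 := block_mx (diag_mx D) 0 0 _ in padD Dpad *.
  have comm : V *m block_mx 1%:M 0 0 D0 = block_mx 1%:M 0 0 D0 *m V.
    rewrite !mulmx_block !mul0mx !mulmx0 !mulmx1 !mul1mx !addr0 !add0r.
    rewrite mulmxBl mulmxBr mul1mx mulmx1 -!scalemxAl -!scalemxAr -mulmxA Dpad.
    by rewrite mulmxA padD.
  have VV : V *m V^t* = 1%:M by exact/unitarymxP.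
  have VV' : V^t* *m V = 1%:M by rewrite -invmx_unitary // mulVmx ?unitarymx_unit.
  apply: (can_inj (mulmxK (unitarymx_unit V_unitary))).
  rewrite -[RHS]mulmxA VV' mulmx1 mulmxBl -!mulmxA -comm (mulmxA (V^t*)) VV' mul1mx.
  rewrite !mulmx_block !mul0mx !mulmx0 !mulmx1 !addr0 !add0r.
  rewrite mulmxBr mulmx1 -!scalemxAr mulmxA padE mul0mx !scaler0 subr0.
  rewrite opp_block_mx add_block_mx !subr0 sub0r !mul_scalar_mx.
  rewrite scale_scalar_mx -raddfB /= [z * a^*]mulrC.
  by congr block_mx; rewrite !scalerA mulrC.
by rewrite det_mulmx det_ublock det_scalar1 mulrC.
Qed.

End Step.
End Colligation.

(** * Realization of a matrix fraction that is unitary on the circle *)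

Section Realization.
Variable C : numClosedFieldType.
Implicit Types (f g : {poly C}) (z w : C).

Definition evalmx m n (F : 'M[{poly C}]_(m, n)) z : 'M[C]_(m, n) :=
  map_mx (horner_eval z) F.

Definition zero_free f := forall z, `|z| <= 1 -> f.[z] != 0.

(** Where [F] is invertible this says that [G F^-1] is unitary on the circle. *)
Definition isogram m (F G : 'M[{poly C}]_m) := forall z, `|z| = 1 ->
  (evalmx F z)^t* *m evalmx F z = (evalmx G z)^t* *m evalmx G z.

Lemma evalmxM m n p (F : 'M[{poly C}]_(m, n)) (G : 'M_(n, p)) z :
  evalmx (F *m G) z = evalmx F z *m evalmx G z.
Proof. exact: map_mxM. Qed.

Lemma evalmxD m n (F G : 'M[{poly C}]_(m, n)) z : evalmx (F + G) z =
  evalmx F z + evalmx G z.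
Proof. exact: map_mxD. Qed.

Lemma evalmxZ m n f (F : 'M[{poly C}]_(m, n)) z : evalmx (f *: F) z =
  f.[z] *: evalmx F z.
Proof. exact: map_mxZ. Qed.

Lemma evalmxC m n (A : 'M[C]_(m, n)) z : evalmx (map_mx polyC A) z = A.
Proof. by apply/matrixP => i j; rewrite !mxE /horner_eval hornerC. Qed.

Lemma det_evalmx m (F : 'M[{poly C}]_m) z : \det (evalmx F z) = (\det F).[z].
Proof. exact: det_map_mx. Qed.

Lemma evalmx_adj m (F : 'M[{poly C}]_m) z : evalmx (\adj F) z = \adj (evalmx F z).
Proof. exact: map_mx_adj. Qed.

Lemma zero_free_neq0 f : zero_free f -> f != 0.
Proof.
move=> /(_ 0); rewrite normr0 ler01 => /(_ isT); apply: contraNneq => ->.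
by rewrite horner0.
Qed.

Lemma zero_freeM f g : zero_free f -> zero_free g -> zero_free (f * g).
Proof. by move=> Hf Hg z z1; rewrite hornerM mulf_neq0 ?Hf ?Hg. Qed.

Lemma zero_free_blaschke_den s : all (fun a => `|a| < 1) s ->
  zero_free (blaschke_den s).
Proof. by move=> sD z z1; exact: horner_blaschke_den_neq0. Qed.

Lemma zero_free_blaschke_factor (a : C) : `|a| < 1 -> zero_free (1 - a^* *: 'X).
Proof. by move=> a1 z z1; rewrite !hornerE blaschke_den_factor_neq0. Qed.

(** The unitary matrix [B A^-1] is the adjoint of its inverse [A B^-1]. Adjugates clear the
    denominators, giving entry by entry the relation required by [zero_free_const]. *)
Lemma adj_isogram m (A B : 'M[C]_m) : \det A != 0 -> A^t* *m A = B^t* *m B ->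
  (\det B)^* *: (B *m \adj A) = \det A *: (A *m \adj B)^t*.
Proof.
move=> dA AB; have uA : A \in unitmx by rewrite unitmxE unitfE.
apply: (can_inj (mulmxK uA)); rewrite -!scalemxAl -mulmxA mul_adj_mx mul_mx_scalar.
rewrite trmx_mul map_mxM -mulmxA AB mulmxA -map_mxM -trmx_mul mul_mx_adj.
by rewrite tr_scalar_mx map_scalar_mx mul_scalar_mx !scalerA mulrC.
Qed.

(** The entries of [G \adj F / \det F] have no pole in the closed disk and by [adj_isogram] are
    conjugate on the circle to fractions of the same kind, so they are constant. *)
Lemma zero_free_isogram m (F G : 'M[{poly C}]_m) :
    zero_free (\det F) -> zero_free (\det G) -> isogram F G ->
  exists2 W : 'M[C]_m, W \is unitarymx & G = map_mx polyC W *m F.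
Proof.
move=> dF dG FG; have [P PE] : exists P, P = G *m \adj F by exists (G *m \adj F).
pose Q := F *m \adj G.
have [W PW] : exists W : 'M[C]_m, P = \det F *: map_mx polyC W.
  exists (\matrix_(i, j) ((P i j).[0] / (\det F).[0])).
  apply/matrixP => i j; rewrite !mxE.
  have [|c Pc] := zero_free_const (P := P i j) (Q := Q j i) dF dG.
    move=> z z1; have FGz := FG _ z1.
    have dFz : \det (evalmx F z) != 0 by rewrite det_evalmx dF ?z1.
    have := adj_isogram dFz FGz; rewrite -!evalmx_adj -!evalmxM -PE -/Q !det_evalmx.
    by move/matrixP/(_ i j); rewrite !mxE mulrC.
  rewrite Pc hornerZ mulfK ?dF ?normr0 ?ler01 //.
  by rewrite mulrC mul_polyC.
have GW : G = map_mx polyC W *m F.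
  have : \det F *: G = \det F *: (map_mx polyC W *m F).
    by rewrite scalemxAl -PW PE -mulmxA mul_adj_mx mul_mx_scalar.
  move=> E; apply/matrixP => i j; move/matrixP/(_ i j): E.
  by rewrite [LHS]mxE [RHS]mxE => /mulfI; apply; exact: zero_free_neq0.
exists W => //; apply/unitarymxP/mulmx1C.
have dF1 : evalmx F 1 \in unitmx by rewrite unitmxE unitfE det_evalmx dF ?normr1.
have := FG 1 (normr1 _); rewrite GW evalmxM evalmxC trmx_mul map_mxM => E.
apply: (can_inj (mulmxK dF1));
  apply: (can_inj (mulKmx (_ : (evalmx F 1)^t* \in unitmx))).
  by rewrite map_unitmx unitmx_tr.
by rewrite mul1mx E !mulmxA.
Qed.

Lemma trmxCZ m n (c : C) (M : 'M[C]_(m, n)) : (c *: M)^t* = c^* *: M^t*.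
Proof. by apply/matrixP => i j; rewrite !mxE rmorphM. Qed.

Lemma evalmx_rank1 m n (u : 'cV[C]_m) (r : 'rV[{poly C}]_n) z :
  evalmx (map_mx polyC u *m r) z = u *m evalmx r z.
Proof. by rewrite evalmxM evalmxC. Qed.

(** The colligation is unitary, and its input and output states differ by the unimodular factor [z];
    their Gram matrices cancel. *)
Lemma peel_isogram m (F F' : 'M[{poly C}]_m) (a : C) (u : 'cV[C]_m) (r : 'rV_m) :
    `|a| < 1 -> u^t* *m u = 1%:M ->
    map_mx polyC (u^t*) *m F' = (1 - a^* *: 'X) *: r ->
    F = F' + (('X - a%:P) - (1 - a^* *: 'X)) *: (map_mx polyC u *m r) ->
  isogram F F'.
Proof.
move=> a1 uu uF' FE z z1.
have uF'z : u^t* *m evalmx F' z = (1 - a^* * z) *: evalmx r z.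
  by rewrite -(evalmxC (u^t*) z) -evalmxM uF' evalmxZ !hornerE.
have FEz : evalmx F z = evalmx F' z + ((z - a) - (1 - a^* * z)) *: (u *m evalmx r z).
  by rewrite FE evalmxD evalmxZ evalmx_rank1 !hornerE.
pose V := bp_colligation a u; have Vu : V \is unitarymx := bp_colligation_unitary a1 uu.
have VV : V^t* *m V = 1%:M by rewrite -invmx_unitary // mulVmx ?unitarymx_unit.
pose y := defect a *: evalmx r z.
have := congr1 (fun M => M^t* *m M) (bp_colligation_apply uu uF'z).
rewrite trmx_mul map_mxM mulmxA -[_ *m _ *m V]mulmxA VV mulmx1 -FEz -/y.
rewrite !tr_col_mx !map_row_mx !mul_row_col !trmxCZ.
rewrite -scalemxAl -scalemxAr scalerA mulrC mul_conj_circle // scale1r.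
by move/addrI.
Qed.

Definition labels (s t : seq C) := nseq (size s) true ++ nseq (size t) false.

(** One state per zero: the zeros of [\det G] in the disk are pulled out first, then those of
    [\det F], until the constant unitary matrix of [zero_free_isogram] remains. The denominators
    created on the way join the zero-free factors [f] and [g]. *)
Lemma realization m (s t : seq C) (F G : 'M[{poly C}]_m) f g :
    all (fun a => `|a| < 1) s -> all (fun a => `|a| < 1) t ->
    zero_free f -> zero_free g ->
    \det G = blaschke_num s * g -> \det F = blaschke_num t * f -> isogram F G ->
  exists (U : 'M[C]_(size (labels s t) + m)) (e : C),
  [/\ U \is unitarymx, `|e| = 1 &
    forall z, `|z| = 1 -> realizes U (evalmx F) (evalmx G) z /\
      charfun U z = e * (blaschke_num s * blaschke_den t).[z]].
Proof.
elim: s F G f g => [|a s IH] F G f g.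
  elim: t F f => [|a t IH] F f _.
    move=> _ ff fg dG dF FG.
    have [|||W Wu GW] := @zero_free_isogram _ F G.
    - by rewrite dF /blaschke_num big_nil mul1r.
    - by rewrite dG /blaschke_num big_nil mul1r.
    - exact: FG.
    exists (W : 'M_(0 + m)), (\det W); split => //; first exact: norm_det_unitary.
    move=> z z1.
    have dlE w : diag_mx (delta_diag [::] m z w) = w%:M :> 'M[C]_m.
      by rewrite -diag_const_mx; congr diag_mx; apply/rowP => i; rewrite !mxE.
    have glE w : diag_mx (gamma_diag [::] m z w) = w%:M :> 'M[C]_m.
      by rewrite -diag_const_mx; congr diag_mx; apply/rowP => i; rewrite !mxE.
    have col0 (M : 'M[C]_m) : col_mx (0 : 'M_(0, m)) M = M :> 'M_m.
      by apply/matrixP => i j; rewrite mxE; case: splitP => [[] //|k E];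
        congr (M _ _); exact: val_inj.
    split.
      exists 0; apply: (etrans (y := W *m evalmx F z)).
        by rewrite [col_mx _ _]col0 [diag_mx _]dlE mul1mx.
      by rewrite [col_mx _ _]col0 [diag_mx _]glE mul1mx GW evalmxM evalmxC.
    rewrite /charfun [diag_mx (delta_diag _ _ _ _)]dlE [diag_mx (gamma_diag _ _ _
      _)]glE mulmx1.
    have h1 : (1 : {poly C}).[z] = 1 by rewrite hornerE.
    by rewrite -[0%:M]/(scalar_mx 0) raddf0 subr0 /blaschke_num /blaschke_den
      !big_nil mulr1 h1 mulr1.
  move=> /andP[a1 tD] ff fg dG dF FG.
  rewrite /blaschke_num big_cons -mulrA in dF.
  have [u [r [F' [uu dF' uF' FE]]]] := peel dF.
  have [|||||||U [e [Uu e1 H]]] := IH F' ((1 - a^* *: 'X) * f) => //.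
  - by apply: zero_freeM => //; exact: zero_free_blaschke_factor.
  - by rewrite dF' mulrCA.
  - by move=> z z1; rewrite -FG // (peel_isogram a1 uu uF' FE).
  pose V := bp_colligation a (pad (size (labels [::] t)) u).
  have Vu : V \is unitarymx by exact/bp_colligation_unitary/pad_unit.
  exists (bordered U *m V^t*), (\det (V^t*) * e); split.
  - by rewrite mul_unitarymx ?bordered_unitary ?trmxC_unitary.
  - by rewrite normrM e1 mulr1 norm_det_unitary ?trmxC_unitary.
  move=> z z1; have [rel ch] := H z z1; split.
    apply: (realizes_pole a1 uu (F' := evalmx F') (r := evalmx r z)) => //.
      by rewrite -(evalmxC (u^t*) z) -evalmxM uF' evalmxZ !hornerE.
    by rewrite FE evalmxD evalmxZ evalmx_rank1 !hornerE.
  rewrite charfun_pole // ch !hornerM !horner_blaschke_den big_cons mulrACA.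
  by congr (_ * _); rewrite mulrCA.
move=> /andP[a1 sD] tD ff fg dG dF FG.
rewrite /blaschke_num big_cons -mulrA in dG.
have [u [r [G' [uu dG' uG' GE]]]] := peel dG.
have [|||||||U [e [Uu e1 H]]] := IH F G' f ((1 - a^* *: 'X) * g) => //.
- by apply: zero_freeM => //; exact: zero_free_blaschke_factor.
- by rewrite dG' mulrCA.
- by move=> z z1; rewrite FG // (peel_isogram a1 uu uG' GE).
pose V := bp_colligation a (pad (size (labels s t)) u).
have Vu : V \is unitarymx by exact/bp_colligation_unitary/pad_unit.
exists (V *m bordered U), (\det V * e); split.
- by rewrite mul_unitarymx ?bordered_unitary.
- by rewrite normrM e1 mulr1 norm_det_unitary.
move=> z z1; have [rel ch] := H z z1; split.
  apply: (realizes_zero uu (G' := evalmx G') (r := evalmx r z)) => //.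
    by rewrite -(evalmxC (u^t*) z) -evalmxM uG' evalmxZ !hornerE.
  by rewrite GE evalmxD evalmxZ evalmx_rank1 !hornerE.
rewrite charfun_zero // ch !hornerM !horner_blaschke_num big_cons mulrACA.
by congr (_ * _); rewrite mulrA.
Qed.

End Realization.

(** * Matrix Fejer-Riesz factorization *)

Section FejerRiesz.
Variable C : numClosedFieldType.
Implicit Types (f g d : {poly C}) (z : C) (s : seq C).

(* Each root in [s] imposes one linear condition on a combination of the columns
   of [B]. *)
Lemma solve_conditions m q s (M : 'M[{poly C}]_m) d (B : 'M[{poly C}]_(m, q)) :
    \det M = blaschke_num s * d ->
  exists L : 'M[C]_(q, size s), forall k (V : 'M[C]_(k, q)), V *m L = 0 ->
    exists Y : 'M[{poly C}]_(m, k), M *m Y = d *: (B *m map_mx polyC V^T).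
Proof.
elim: s M B => [|a s IH] M B.
  rewrite /blaschke_num big_nil mul1r => dM; exists 0 => k V _.
  by exists (\adj M *m (B *m map_mx polyC V^T));
    rewrite mulmxA mul_mx_adj mul_scalar_mx dM.
rewrite /blaschke_num big_cons -mulrA => /left_factor[u [N [uu dN ->]]].
set us := map_mx polyC (u^t*); set pu := map_mx polyC u.
have usu : us *m pu = 1%:M by rewrite -map_mxM uu map_mx1.
set l := 'X - a%:P.
pose c : 'rV[C]_q := evalmx (us *m B) a.
pose r : 'rV[{poly C}]_q := map_mx (fun f => f %/ l) (us *m B).
have usB : us *m B = l *: r + map_mx polyC c.
  apply/matrixP => i j; rewrite [LHS](divp_eq _ l).
  rewrite [RHS]mxE; congr (_ + _); first by rewrite [RHS]mxE [X in _ = _ * X]mxE mulrC.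
  by rewrite modp_XsubC [RHS]mxE; congr (_%:P); rewrite [RHS]mxE.
pose B1 := B + pu *m (r - us *m B).
have [L HL] := IH N B1 dN.
exists (row_mx (c^T : 'M_(q, 1)) L) => k V VcL.
have /eq_row_mx[Vc /HL[Y NY]] : row_mx (V *m c^T) (V *m L) = row_mx 0 0.
  by rewrite -mul_mx_row row_mx0.
exists Y; have cV : map_mx polyC c *m map_mx polyC V^T = 0.
  by rewrite -map_mxM -[c]trmxK -trmx_mul Vc trmx0 map_mx0.
have usB1 : us *m B1 = r.
  by rewrite mulmxDr mulmxA usu mul1mx addrC subrK.
rewrite mulmxDl -scalemxAl -!mulmxA NY -!scalemxAr !(mulmxA us) usB1.
rewrite scalerA [_ * d]mulrC -scalerA -scalerDr; congr (_ *: _).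
rewrite /B1 mulmxDl -addrA -mulmxA scalemxAr -mulmxDr.
rewrite [X in pu *m X](_ : _ = 0) ?mulmx0 ?addr0 //.
rewrite mulmxBl usB mulmxDl cV addr0 -scalemxAl; move: (r *m _) => w.
by apply/matrixP => i j; rewrite !mxE; ring.
Qed.

(** The columns form a basis of the vectors of polynomials of degree at most [N]; Euclidean division
    by [N + 1] splits a column index into a row and an exponent. *)
Definition monomials m N : 'M[{poly C}]_(m, m * N.+1) :=
  \matrix_(i, c) if (c %/ N.+1 == i)%N then 'X^(c %% N.+1) else 0.

Lemma monomials_inj m N k (V : 'M[C]_(m * N.+1, k)) :
  monomials m N *m map_mx polyC V = 0 -> V = 0.
Proof.
move=> E; apply/matrixP => c j; rewrite [RHS]mxE.
have im : (c %/ N.+1 < m)%N by rewrite ltn_divLR.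
have := congr1 (fun M : 'M[{poly C}]_(m, k) => (M (Ordinal im) j)`_(c %% N.+1)) E.
rewrite !mxE coef0 coef_sum (bigD1 c) //= !mxE eqxx coefMC coefXn eqxx mul1r.
rewrite big1 ?addr0 // => c' c'c; rewrite !mxE /=; case: eqP => [dE|_]; last first.
  by rewrite mul0r coef0.
rewrite coefMC coefXn; case: eqP => [mE|_]; last by rewrite mul0r.
by case/eqP: c'c; apply: val_inj; rewrite /= (divn_eq c' N.+1) (divn_eq c N.+1) dE mE.
Qed.

Lemma size_monomials m N k (V : 'M[C]_(m * N.+1, k)) i j :
  (size ((monomials m N *m map_mx polyC V) i j) <= N.+1)%N.
Proof.
rewrite mxE; apply: (leq_trans (size_sum _ _ _)); apply/bigmax_leqP => c _.
rewrite !mxE; case: ifP => _; last by rewrite mul0r size_poly0.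
rewrite mulrC mul_polyC (leq_trans (size_scale_leq _ _)) // size_polyXn.
by rewrite ltn_mod.
Qed.

Lemma row_free_kernel q k m (L : 'M[C]_(q, k)) : (m + k <= q)%N ->
  exists2 V : 'M[C]_(m, q), row_free V & V *m L = 0.
Proof.
move=> mkq; have rK : (m <= \rank (kermx L))%N.
  by rewrite mxrank_ker; have := rank_leq_col L; lia.
exists (pid_mx m *m row_base (kermx L)).
  by rewrite /row_free mxrankMfree ?row_base_free // rank_pid_mx.
rewrite -mulmxA; have /sub_kermxP -> : (row_base (kermx L) <= kermx L)%MS.
  by rewrite eq_row_base.
by rewrite mulmx0.
Qed.

Lemma disk_root_split d : d != 0 -> (forall z, `|z| = 1 -> d.[z] != 0) ->
  exists2 d', zero_free d' & d = blaschke_num (disk_roots d) * d'.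
Proof.
move=> d0 dT; rewrite /disk_roots; set r := sval _.
have dE : d = lead_coef d *: \prod_(a <- r) ('X - a%:P).
  exact: (svalP (closed_field_poly_normal d)).
exists (lead_coef d *: \prod_(a <- r | ~~ (`|a| < 1)) ('X - a%:P)).
  move=> z z1; rewrite hornerZ mulf_neq0 ?lead_coef_eq0 // horner_prod.
  rewrite prodf_seq_neq0; apply/allP => a ar; apply/implyP => a1.
  rewrite hornerXsubC subr_eq0; apply: contraNneq a1 => za.
  rewrite -za lt_neqAle z1 andbT; apply/negP => /eqP /dT.
  by rewrite dE hornerZ horner_prod (big_rem a) //= hornerXsubC za subrr mul0r mulr0
    eqxx.
rewrite -scalerAr {1}dE; congr (_ *: _).
by rewrite (bigID (fun a => `|a| < 1)) /blaschke_num big_filter.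
Qed.

(* [d / z^n] is real on the circle, so [d] has as many roots inside as outside. *)
Lemma disk_root_count n d : (forall z, `|z| = 1 -> d.[z] != 0) ->
    (forall z, `|z| = 1 -> z ^+ (2 * n) * (d.[z])^* = d.[z]) ->
  (size (disk_roots d) <= n)%N.
Proof.
move=> dT dR; set s := disk_roots d.
have d0 : d != 0.
  by apply: contraTneq (dT 1 (normr1 _)) => ->; rewrite horner0 eqxx.
(* [K] is a provisional degree: reversal at [K] shows that [d] has degree at most [2n], after which
   reversal at [2n] is available. *)
pose K := (size d + 2 * n)%N; have sdK : (size d <= K.+1)%N by rewrite /K; lia.
have XE : revp K d = 'X^(size d) * d.
  by apply: revpE => // z z1; rewrite hornerM hornerXn /K exprD -mulrA dR.
have sd : (size d <= (2 * n).+1)%N.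
  have := size_revp K d; rewrite XE mulrC size_mulXn // /K; lia.
have RE : revp (2 * n) d = d by apply: revpE => // z z1; rewrite dR.
have [s' [k [k0 s'D ss' dE]]] := revp_factor d0 sd dT; rewrite RE -/s in ss' dE.
have [d' _ dE'] := disk_root_split d0 dT; rewrite -/s in dE'.
have sD : all (fun a => `|a| < 1) s := disk_roots_disk d.
have cop : coprimep (blaschke_num s) (blaschke_den s).
  apply: coprimep_no_common_root; first exact: blaschke_num_neq0.
  move=> z; rewrite root_prod_XsubC => zs; apply: horner_blaschke_den_neq0 => //.
  by rewrite ltW // (allP sD).
(* So [size s <= size s'], while the two sizes add up to [2n]. *)
have : blaschke_num s %| blaschke_num s'.
  rewrite -(Gauss_dvdpl _ cop) -(dvdpZr _ _ k0) -dE dE'.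
  exact: dvdp_mulr.
move/dvdp_leq => /(_ (blaschke_num_neq0 _)); rewrite !size_prod_XsubC; lia.
Qed.

Lemma col_gram_eq0 m (x : 'cV[C]_m) : x^t* *m x = 0 -> x = 0.
Proof.
move=> E; rewrite -[x]trmxCK; have [->|/dotmx_gt0] := eqVneq (x^t*) 0.
  by rewrite trmx0 map_mx0.
by rewrite dotmxE trmxCK E mxE ltxx.
Qed.

(** Let [d] be the zero-free part of [\det J]. A solution of [J Y = d B] with [B] of degree at most
    [N] gives [A = z^N B^*] on the circle, and [A Y = d g] with [g] constant by the Liouville
    argument. Normalizing [g] turns [A] into the required factor. *)
Lemma fejer_riesz m N (J : 'M[{poly C}]_m) :
    (forall z, `|z| = 1 -> exists2 S : 'M[C]_m, S \in unitmx &
       evalmx J z = z ^+ N *: (S^t* *m S)) ->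
  exists2 A : 'M[{poly C}]_m, zero_free (\det A) &
    forall z, `|z| = 1 -> evalmx J z = z ^+ N *: ((evalmx A z)^t* *m evalmx A z).
Proof.
move=> HJ.
have dS z (S : 'M[C]_m) : evalmx J z = z ^+ N *: (S^t* *m S) ->
    (\det J).[z] = z ^+ (m * N) * `|\det S| ^+ 2.
  move=> E; rewrite -det_evalmx E detZ -exprM mulnC det_mulmx det_map_mx det_tr.
  by rewrite [_^* * _]mulrC -normCK.
have dT z : `|z| = 1 -> (\det J).[z] != 0.
  move=> z1; have [S uS /dS ->] := HJ z z1.
  move: uS; rewrite unitmxE unitfE => S0.
  by rewrite mulf_eq0 !expf_eq0 normr_eq0 (negbTE S0) (negbTE (circle_neq0 z1)) !andbF.
have d0 : \det J != 0.
  by apply: contraTneq (dT 1 (normr1 _)) => ->; rewrite horner0 eqxx.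
have cnt := @disk_root_count (m * N) _ dT.
have [dE dEf dJE] := disk_root_split d0 dT.
move: cnt dJE; set s := disk_roots _ => cnt dJE.
have {}cnt : (size s <= m * N)%N.
  apply: cnt => z z1; have [S uS /dS ->] := HJ z z1.
  rewrite rmorphM !rmorphXn /= conj_normC mulrA mul2n -addnn exprD; congr (_ * _).
  by rewrite -mulrA -exprMn mul_conj_circle // expr1n mulr1.
(* [m (N + 1)] coefficients under at most [m N] conditions leave [m] columns. *)
have [L HL] := solve_conditions (monomials m N) dJE.
have [V Vfree /HL[Y JY]] : exists2 V : 'M[C]_(m, m * N.+1), row_free V & V *m L = 0.
  by apply: row_free_kernel; rewrite mulnS leq_add2l.
set B := monomials m N *m _ in JY.
have sB i j : (size (B i j) <= N.+1)%N by exact: size_monomials.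
have [A AE] : exists A : 'M[{poly C}]_m, forall z, `|z| = 1 -> evalmx A z =
  z ^+ N *: (evalmx B z)^t*.
  exists (\matrix_(i, j) revp N (B j i)) => z z1; apply/matrixP => i j.
  by clearbody B; rewrite !mxE /horner_eval horner_revp.
(* With [J = z^N S^* S], the matrix [X := S^-* B] has a constant Gram matrix. *)
have XE z (S : 'M[C]_m) : `|z| = 1 -> S \in unitmx -> evalmx J z =
  z ^+ N *: (S^t* *m S) ->
    exists2 X : 'M[C]_m, S^t* *m X = evalmx B z & evalmx (A *m Y) z =
      dE.[z] *: (X^t* *m X).
  move=> z1 uS JS; have uS' : S^t* \in unitmx by rewrite map_unitmx unitmx_tr.
  exists (invmx (S^t*) *m evalmx B z); first by rewrite mulKVmx.
  set X := invmx _ *m _; have SX : S^t* *m X = evalmx B z by rewrite mulKVmx.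
  have := congr1 (fun M => evalmx M z) JY;
    rewrite evalmxM evalmxZ JS -SX -scalemxAl -mulmxA => E.
  have {}E : z ^+ N *: (S *m evalmx Y z) = dE.[z] *: X.
    apply: (can_inj (mulKmx uS')); rewrite -!scalemxAr -E.
    by [].
  rewrite evalmxM AE // -SX trmx_mul map_mxM trmxCK -scalemxAl -mulmxA scalemxAr.
  by rewrite E -scalemxAr.
(* On the circle [A Y / dE] is a Gram matrix, hence Hermitian, hence constant. *)
have [g AYg] : exists g : 'M[C]_m, A *m Y = dE *: map_mx polyC g.
  have [P PE] : exists P, P = A *m Y by exists (A *m Y).
  rewrite -PE; exists (\matrix_(i, j) ((P i j).[0] / dE.[0])).
  apply/matrixP => i j; rewrite !mxE.
  have [|c ->] := zero_free_const (P := P i j) (Q := P j i) dEf dEf.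
    move=> z z1; have [S uS JS] := HJ z z1.
    have [X _] := XE z S z1 uS JS; rewrite -PE => E.
    have Eij i' j' : (P i' j').[z] = dE.[z] * (X^t* *m X) i' j'.
      by have /matrixP/(_ i' j') := E; rewrite !mxE.
    rewrite !Eij rmorphM -mulrA; congr (_ * _).
    rewrite mulrC; congr (_ * _).
    rewrite !mxE rmorph_sum; apply: eq_bigr => k _.
    by rewrite !mxE rmorphM /= conjCK mulrC.
  by rewrite hornerZ mulfK ?dEf ?normr0 ?ler01 // mulrC mul_polyC.
have gE z (S : 'M[C]_m) : `|z| = 1 -> S \in unitmx -> evalmx J z =
  z ^+ N *: (S^t* *m S) ->
    exists2 X : 'M[C]_m, S^t* *m X = evalmx B z & g = X^t* *m X.
  move=> z1 uS JS; have [X SX] := XE z S z1 uS JS; rewrite AYg evalmxZ evalmxC => E.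
  by exists X => //; apply: (scalerI _ E); rewrite dEf ?z1.
(* A kernel vector of [g] kills every [X], hence [B], whose columns are independent. *)
have ug : g \in unitmx.
  rewrite -unitmx_tr -row_free_unit -kermx_eq0; apply/eqP/row_matrixP => i;
    rewrite row0.
  set v := row i _; have gv : g *m v^T = 0.
    by rewrite -[g]trmxK -trmx_mul -row_mul mulmx_ker row0 trmx0.
  have Bv : B *m map_mx polyC v^T = 0.
    apply/matrixP => j k; rewrite [RHS]mxE; apply: poly_circle0 => z z1.
    have [S uS JS] := HJ z z1; have [X SX gX] := gE z S z1 uS JS.
    have Xv : X *m v^T = 0.
      apply: col_gram_eq0.
      by rewrite trmx_mul map_mxM -mulmxA (mulmxA _ X) -gX gv mulmx0.
    have : evalmx (B *m map_mx polyC v^T) z = 0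
      by rewrite evalmxM evalmxC -SX -mulmxA Xv mulmx0.
    by move/matrixP/(_ j k); rewrite [LHS]mxE [RHS]mxE.
  have : monomials m N *m map_mx polyC (V^T *m v^T) = 0 by rewrite map_mxM mulmxA.
  move/monomials_inj; rewrite -trmx_mul => /(congr1 trmx); rewrite trmxK trmx0.
  by move/eqP; rewrite mulmx_free_eq0 // => /eqP.
have [S1 uS1 JS1] := HJ 1 (normr1 _).
have [X1 _ gX1] := gE 1 S1 (normr1 _) uS1 JS1.
have uX z (X : 'M[C]_m) : g = X^t* *m X -> X \in unitmx.
  by move=> gX; move: ug; rewrite gX unitmx_mul => /andP[].
(* [R] normalizes the constant matrix: [R R^* = g^-1]. *)
have uX1 := uX 1 X1 gX1; pose R := invmx X1.
exists (map_mx polyC (R^t*) *m A).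
  move=> z zD; rewrite det_mulmx hornerM mulf_neq0 //.
    by rewrite det_map_mx hornerC -unitfE -unitmxE map_unitmx unitmx_tr unitmx_inv.
  (* The determinant of [A Y = dE g] has no zero in the closed disk, so neither has its factor
     [\det A]. *)
  have := congr1 (fun M => \det (evalmx M z)) AYg.
  rewrite evalmxM det_mulmx evalmxZ evalmxC detZ det_evalmx => E.
  have : (\det A).[z] * \det (evalmx Y z) != 0.
    by rewrite E mulf_neq0 ?expf_neq0 ?dEf // -unitfE -unitmxE.
  by rewrite mulf_eq0 negb_or => /andP[].
move=> z z1; have [S uS JS] := HJ z z1; have [X SX gX] := gE z S z1 uS JS.
rewrite JS; congr (_ *: _); rewrite evalmxM evalmxC AE //.
have uXz := uX z X gX.
rewrite -scalemxAr trmxCZ -scalemxAl -scalemxAr scalerA mulrC mul_conj_circle;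
  last first.
  by rewrite normrX z1 expr1n.
rewrite scale1r trmx_mul map_mxM !trmxCK -!mulmxA (mulmxA R).
have -> : R *m R^t* = invmx g.
  apply: (can_inj (mulKmx ug)); rewrite mulmxV // {1}gX1 -mulmxA (mulmxA X1) mulmxV //.
  by rewrite mul1mx -map_mxM -trmx_mul mulVmx // trmx1 map_mx1.
have Xg : X *m (invmx g *m X^t*) = 1%:M.
  have uXs : X^t* \in unitmx by rewrite map_unitmx unitmx_tr.
  by apply: (can_inj (mulKmx uXs)); rewrite !mulmxA -gX mulmxV // mul1mx mulmx1.
rewrite -SX trmx_mul map_mxM trmxCK -!mulmxA; congr (_ *m _).
by rewrite (mulmxA (invmx g)) (mulmxA X) Xg mul1mx.
Qed.

End FejerRiesz.

(** * Companion matrices and power sums of the roots *)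

Section SimpleRoots.
Variable C : numClosedFieldType.
Implicit Types (p : {poly {poly C}}) (z w : C).

Definition slice p z : {poly C} := map_poly (horner_eval z) p.

Lemma horner_slice p z w : (slice p z).[w] = p.[w, z].
Proof.
have -> : w = horner_eval z w%:P by rewrite /horner_eval hornerC.
by rewrite /slice horner_map /= /horner_eval hornerC.
Qed.

Lemma coef_slice p z j : (slice p z)`_j = (p`_j).[z].
Proof. by rewrite coef_map. Qed.

Variables (k : nat) (p : {poly {poly C}}).
Local Notation m := k.+1.

Definition simple_on_circle := forall z, `|z| = 1 ->
  exists r : 'I_m -> C, [/\ injective r, (forall i, `|r i| = 1), (p`_m).[z] != 0 &
    slice p z = (p`_m).[z] *: \prod_i ('X - (r i)%:P)].

(* [comp_num comp_den^-1] is the companion matrix that has the row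
   [(1, r, .., r^k)] as left eigenvector for each root [r] of [p(z, .)];
   [comp_int] is its product by the leading coefficient of [p]. *)
Definition comp_num : 'M[{poly C}]_m :=
  \matrix_(i, j) if j == ord_max then - p`_i else (i == j.+1 :> nat)%:R.
Definition comp_den : 'M[{poly C}]_m :=
  diag_mx (\row_j if j == ord_max then p`_m else 1).
Definition comp_int : 'M[{poly C}]_m :=
  \matrix_(i, j) if j == ord_max then - p`_i else p`_m *+ (i == j.+1 :> nat).

Lemma det_comp_den : \det comp_den = p`_m.
Proof.
rewrite det_diag (bigD1 ord_max) //= mxE eqxx big1 ?mulr1 // => i im.
by rewrite mxE (negbTE im).
Qed.

Definition vdm (r : 'I_m -> C) : 'M[C]_m := \matrix_(i, j) r i ^+ j.
Definition dmx (r : 'I_m -> C) : 'M[C]_m := diag_mx (\row_i r i).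

Lemma vdm_unit r : injective r -> vdm r \in unitmx.
Proof.
move=> rI; have -> : vdm r = (Vandermonde m (\row_i r i))^T.
  by apply/matrixP => i j; rewrite !mxE.
rewrite unitmx_tr unitmxE det_Vandermonde unitfE.
apply/prodf_neq0 => i _; apply/prodf_neq0 => j ij; rewrite !mxE subr_eq0.
by apply/negP => /eqP /rI E; rewrite E ltnn in ij.
Qed.

Section At.
Variables (z : C) (r : 'I_m -> C).
Hypothesis pE : slice p z = (p`_m).[z] *: \prod_i ('X - (r i)%:P).

Lemma root_sum i : - \sum_(j < m) (p`_j).[z] * r i ^+ j = (p`_m).[z] * r i ^+ m.
Proof.
have : (slice p z).[r i] = 0.
  by rewrite pE hornerZ horner_prod (bigD1 i) //= hornerXsubC subrr mul0r mulr0.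
have ssl : (size (slice p z) <= m.+1)%N.
  rewrite pE (leq_trans (size_scale_leq _ _)) //.
  by rewrite size_prod_XsubC /index_enum -enumT size_enum_ord.
rewrite (horner_coef_wide _ ssl) big_ord_recr /= coef_slice => /eqP.
rewrite addr_eq0 => /eqP E; rewrite -[RHS]opprK -E; congr (- _).
by apply: eq_bigr => j _; rewrite coef_slice.
Qed.

Lemma vdm_comp_num :
  vdm r *m evalmx comp_num z = dmx r *m (vdm r *m evalmx comp_den z).
Proof.
apply/matrixP => i j;
  rewrite mul_diag_mx /comp_den /evalmx map_diag_mx mul_mx_diag !mxE.
rewrite /horner_eval; case: eqVneq => [jE|jm].
  rewrite jE /= mulrA -exprS mulrC -root_sum -sumrN; apply: eq_bigr => l _.
  by rewrite !mxE eqxx /horner_eval hornerN mulrN mulrC.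
have jk : (j.+1 < m)%N.
  by rewrite ltn_neqAle ltn_ord andbT; apply: contra jm => /eqP [E]; apply/eqP/val_inj.
have hb (b : bool) : (b%:R : {poly C}).[z] = b%:R by case: b; rewrite !hornerE.
rewrite rmorph1 mulr1 -exprS (bigD1 (Ordinal jk)) //= !mxE (negbTE jm) eqxx hb.
rewrite mulr1 big1 ?addr0 // => l lj; rewrite !mxE (negbTE jm) hb.
rewrite (_ : (_ == _) = false) ?mulr0 //.
by apply: contraNF lj => /eqP E; apply/eqP/val_inj.
Qed.

Lemma vdm_comp_int :
  vdm r *m evalmx comp_int z = ((p`_m).[z] *: dmx r) *m vdm r.
Proof.
have -> : comp_int = comp_num *m diag_mx (\row_j if j == ord_max then 1 else p`_m).
  apply/matrixP => i j; rewrite mul_mx_diag !mxE; case: eqP => _.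
    by rewrite mulr1.
  by rewrite mulr_natl.
rewrite evalmxM mulmxA vdm_comp_num -!mulmxA -evalmxM.
have -> : comp_den *m diag_mx (\row_j if j == ord_max then 1 else p`_m) = (p`_m)%:M.
  rewrite /comp_den mulmx_diag -diag_const_mx; congr diag_mx.
  by apply/rowP => j; rewrite !mxE; case: eqP => _; rewrite ?mulr1 ?mul1r.
by rewrite /evalmx map_scalar_mx mul_mx_scalar -scalemxAl -scalemxAr.
Qed.

(** [comp_int] is polynomial in [z] and similar to the diagonal matrix of the roots times the
    leading coefficient; its traces make the scaled power sums polynomial. *)
Lemma trace_comp_int l : injective r ->
  (\tr (comp_int ^+ l)).[z] = (p`_m).[z] ^+ l * \sum_i r i ^+ l.
Proof.
move=> /vdm_unit uV.
have E : vdm r *m evalmx (comp_int ^+ l) z = ((p`_m).[z] ^+ l *: (dmx r) ^+ l) *m vdm r.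
  elim: l => [|l IH].
    by rewrite !expr0 scale1r mul1mx /evalmx map_mx1 mulmx1.
  rewrite !exprSr -mulmxE evalmxM mulmxA IH -mulmxA vdm_comp_int mulmxA.
  by congr (_ *m _); rewrite -scalemxAl -scalemxAr scalerA.
have {}E : evalmx (comp_int ^+ l) z =
  invmx (vdm r) *m (((p`_m).[z] ^+ l *: (dmx r) ^+ l) *m vdm r).
  by rewrite -E mulKmx.
have -> : (\tr (comp_int ^+ l)).[z] = \tr (evalmx (comp_int ^+ l) z).
  by rewrite /mxtrace horner_sum; apply: eq_bigr => i _; rewrite !mxE.
rewrite E mxtrace_mulC -mulmxA mulmxV // mulmx1 mxtraceZ; congr (_ * _).
have -> : dmx r ^+ l = diag_mx (\row_i r i ^+ l).
  elim: l {E} => [|l IH].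
    by rewrite expr0 -[LHS]/(1%:M) -diag_const_mx; congr diag_mx; apply/rowP => i;
      rewrite !mxE.
  rewrite exprS IH -mulmxE mulmx_diag; congr diag_mx.
  by apply/rowP => i; rewrite !mxE exprS.
by rewrite mxtrace_diag; apply: eq_bigr => i _; rewrite mxE.
Qed.

Lemma det_comp_pencil w : injective r ->
  \det (w *: evalmx comp_den z - evalmx comp_num z) = p.[w, z].
Proof.
move=> /vdm_unit uV; have V0 : \det (vdm r) != 0 by rewrite -unitfE -unitmxE.
apply: (mulfI V0); rewrite -det_mulmx mulmxBr vdm_comp_num -scalemxAr.
have -> : w *: (vdm r *m evalmx comp_den z) - dmx r *m (vdm r *m evalmx comp_den z) =
    diag_mx (\row_i (w - r i)) *m (vdm r *m evalmx comp_den z).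
  rewrite -mul_scalar_mx -mulmxBl; congr (_ *m _); rewrite -diag_const_mx -raddfB /=.
  by congr diag_mx; apply/rowP => i; rewrite !mxE.
rewrite !det_mulmx det_diag mulrCA; congr (_ * _).
rewrite det_evalmx det_comp_den -horner_slice pE hornerZ mulrC; congr (_ * _).
by rewrite horner_prod; apply: eq_bigr => i _; rewrite !mxE hornerXsubC.
Qed.

End At.
End SimpleRoots.

(** * The determinantal formula when the roots are simple *)

Section SimpleRootsRealization.
Variable C : numClosedFieldType.
Variables (k : nat) (p : {poly {poly C}}).
Local Notation m := k.+1.
Hypothesis p_simple : simple_on_circle k p.

(** On the circle [S l] is [P] times the power sum of order [l]. [N] is a common degree at which [P]
    and all [S l] with [l < m] can be reversed. *)
Let P : {poly C} := p`_m ^+ m.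
Let S l : {poly C} := p`_m ^+ (m - l) * \tr (comp_int k p ^+ l).
Let N := (size P + \sum_(l < m) size (S l))%N.

(* On the circle the Gram matrix of the Vandermonde matrix has the power sums of
   the roots and their conjugates as entries, and the power sums are traces. *)
Definition power_sum_gram : 'M[{poly C}]_m :=
  \matrix_(i, j) if (i <= j)%N then revp N P * S (j - i) else P * revp N (S (i - j)).

Lemma power_sum_gramE z r : `|z| = 1 -> injective r -> (forall i, `|r i| = 1) ->
    slice p z = (p`_m).[z] *: \prod_(i < m) ('X - (r i)%:P) ->
  evalmx power_sum_gram z =
  z ^+ N *: ((P.[z] *: vdm r)^t* *m (P.[z] *: vdm r)).
Proof.
move=> z1 rI r1 pE.
have SE l : (l <= m)%N -> (S l).[z] = P.[z] * \sum_(i < m) r i ^+ l.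
  move=> lm; rewrite /S /P hornerM (trace_comp_int pE) // mulrA !horner_exp -exprD.
  by rewrite subnK.
have sP : (size P <= N.+1)%N by rewrite leqW // leq_addr.
have sS l : (l < m)%N -> (size (S l) <= N.+1)%N.
  move=> lm; rewrite leqW // /N (bigD1 (Ordinal lm)) //= addnCA leq_addr //.
have pw (a : C) i j : `|a| = 1 -> (i <= j)%N -> (a ^+ i)^* * a ^+ j = a ^+ (j - i).
  move=> a1 ij; rewrite -{1}(subnK ij) exprD mulrCA rmorphXn /= -exprMn.
  by rewrite [a^* * a]mulrC mul_conj_circle // expr1n mulr1.
apply/matrixP => i j; rewrite trmxCZ -scalemxAl -scalemxAr !mxE /horner_eval.
have [ij|ji] := leqP i j.
  rewrite hornerM horner_revp // SE;
    last by rewrite leq_subLR (leq_trans (ltnW (ltn_ord j))) // leq_addl.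
  rewrite -!mulrA; congr (_ * (_ * (_ * _))); apply: eq_bigr => l _.
  by rewrite !mxE pw.
rewrite hornerM horner_revp ?sS //; last by rewrite ltn_subLR ?ltn_addl // ltnW.
rewrite SE; last by rewrite leq_subLR (leq_trans (ltnW (ltn_ord i))) // leq_addl.
rewrite rmorphM /= [LHS]mulrCA; congr (_ * _); rewrite mulrCA; congr (_ * (_ * _)).
rewrite rmorph_sum; apply: eq_bigr => l _.
by rewrite !mxE -[in RHS](conjCK (r l ^+ j)) -rmorphM mulrC pw // ltnW.
Qed.

(** In the basis of left eigenvectors the companion matrix acts as the unitary [dmx r], so
    [A comp_num] and [A comp_den] have the same Gram matrix on the circle. [realization] then
    applies, and [\det A] and the [charfun] factor cancel in [realizes_det]. *)
Lemma simple_det_realization (s : seq C) (c : C) :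
    c != 0 -> all (fun a => `|a| < 1) s ->
    p`_m = c *: (blaschke_num s * blaschke_den (disk_roots p`_0)) ->
  exists (U : 'M[C]_(size (labels s (disk_roots p`_0)) + m)) (e : C),
  [/\ U \is unitarymx, `|e| = 1 &
    forall z w, `|z| = 1 ->
    c * \det (U *m diag_mx (delta_diag (labels s (disk_roots p`_0)) m z w) -
              diag_mx (gamma_diag (labels s (disk_roots p`_0)) m z 1)) = e * p.[w, z]].
Proof.
move=> c0 sD pmE; set t := disk_roots _.
have [A Af AE] : exists2 A : 'M[{poly C}]_m, zero_free (\det A) &
    forall z, `|z| = 1 -> evalmx power_sum_gram z =
      z ^+ N *: ((evalmx A z)^t* *m evalmx A z).
  apply: fejer_riesz => z z1; have [r [rI r1 pm0 pE]] := p_simple z1.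
  exists (P.[z] *: vdm r); last exact: power_sum_gramE.
  by rewrite unitmxZ ?vdm_unit // unitfE horner_exp expf_neq0.
pose F := A *m comp_num k p; pose G := A *m comp_den k p.
have FG : isogram F G.
  move=> z z1; have [r [rI r1 pm0 pE]] := p_simple z1.
  have AA : (evalmx A z)^t* *m evalmx A z = (P.[z] *: vdm r)^t* *m (P.[z] *: vdm r).
    have := AE z z1; rewrite (power_sum_gramE z1 rI r1 pE) => /scalerI -> //.
    by rewrite expf_neq0 // circle_neq0.
  have gram (X : 'M[{poly C}]_m) : (evalmx (A *m X) z)^t* *m evalmx (A *m X) z =
      (P.[z] *: (vdm r *m evalmx X z))^t* *m (P.[z] *: (vdm r *m evalmx X z)).
    rewrite evalmxM trmx_mul map_mxM -mulmxA (mulmxA ((evalmx A z)^t*)) AA.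
    by rewrite scalemxAl [in RHS]trmx_mul [in RHS]map_mxM -!mulmxA.
  rewrite !gram (vdm_comp_num pE) !trmxCZ trmx_mul map_mxM.
  rewrite -!scalemxAl -!scalemxAr -mulmxA (mulmxA _ (dmx r)).
  have -> : (dmx r)^t* *m dmx r = 1%:M.
    rewrite /dmx tr_diag_mx map_diag_mx mulmx_diag -diag_const_mx; congr diag_mx.
    by apply/rowP => i; rewrite !mxE mulrC mul_conj_circle.
  by rewrite mul1mx.
have p0T z : `|z| = 1 -> (p`_0).[z] = (-1) ^+ m * \det (evalmx (comp_num k p) z).
  move=> z1; have [r [rI r1 pm0 pE]] := p_simple z1.
  have := det_comp_pencil pE 0 rI; rewrite scale0r sub0r -scaleN1r detZ => ->.
  by rewrite -horner_slice horner_coef0 coef_slice.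
have dnum : \det (comp_num k p) = (-1) ^+ m *: p`_0.
  apply: eq_poly_circle => z z1; rewrite hornerZ p0T // mulrA -exprMn mulrN1 opprK.
  by rewrite expr1n mul1r det_evalmx.
have p0n z : `|z| = 1 -> (p`_0).[z] != 0.
  move=> z1; have [r [rI r1 pm0 pE]] := p_simple z1.
  rewrite -[_.[z]]mul1r -coef_slice -horner_coef0 pE hornerZ mul1r mulf_neq0 //.
  rewrite horner_prod; apply/prodf_neq0 => i _.
  by rewrite hornerXsubC sub0r oppr_eq0 -normr_eq0 r1 oner_eq0.
have p00 : p`_0 != 0.
  by apply: contraTneq (p0n 1 (normr1 _)) => ->; rewrite horner0 eqxx.
have [d' d'f p0E] := disk_root_split p00 p0n; rewrite -/t in p0E.
have tD : all (fun a => `|a| < 1) t := disk_roots_disk _.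
(* The zeros in the disk are those of [p_0] for [F] and those of [p_m] for [G], since [\det A] has
   none. *)
have dF : \det F = blaschke_num t * (\det A * ((-1) ^+ m *: d')).
  by rewrite det_mulmx dnum {1}p0E mulrCA scalerAr.
have dG : \det G = blaschke_num s * (\det A * (c *: blaschke_den t)).
  by rewrite det_mulmx det_comp_den pmE -!scalerAr mulrCA.
have [||U [e [Uu e1 H]]] := realization sD tD _ _ dG dF FG.
- apply: zero_freeM => // z z1; rewrite hornerZ mulf_neq0 ?d'f //.
  by rewrite expf_neq0 // oppr_eq0 oner_eq0.
- apply: zero_freeM => // z z1; rewrite hornerZ mulf_neq0 //.
  exact: zero_free_blaschke_den.
exists U, e; split => // z w z1; have [rel ch] := H z z1.
have [r [rI r1 pm0 pE]] := p_simple z1.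
have := realizes_det w rel; rewrite ch det_evalmx det_mulmx det_comp_den.
have -> : w *: evalmx G z - evalmx F z =
  evalmx A z *m (w *: evalmx (comp_den k p) z - evalmx (comp_num k p) z).
  by rewrite mulmxBr -scalemxAr !evalmxM.
rewrite det_mulmx (det_comp_pencil pE) // det_evalmx hornerM pmE hornerZ.
have dA0 : (\det A).[z] != 0 by rewrite Af ?z1.
have q0 : (blaschke_num s * blaschke_den t).[z] != 0.
  by move: pm0; rewrite pmE hornerZ mulf_eq0 negb_or => /andP[].
set q := (blaschke_num s * blaschke_den t).[z] in q0 *; set D := \det _ => E.
apply: (mulfI dA0); apply: (mulfI q0).
by transitivity (D * ((\det A).[z] * (c * q))); [ring | rewrite E; ring].
Qed.

End SimpleRootsRealization.

(** * Reordering of the coordinates *)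

Section Reindex.
Variable C : numClosedFieldType.
Implicit Types (z w : C).

Definition delta_row m n n1 z w : 'rV[C]_(m + n) :=
  \row_i if (i < m)%N then w else if (i < m + n1)%N then z else 1.
Definition gamma_row m n n1 z : 'rV[C]_(m + n) :=
  \row_i if (i < m + n1)%N then 1 else z.

(** [P] and [Q] are typed as rectangular because [m + k] and [k + m] are equal but not
    convertible. *)
Lemma det_conj_rect a b (P : 'M[C]_(a, b)) (Q : 'M_(b, a)) (M : 'M_b) :
  a = b -> P *m Q = 1%:M -> \det (P *m M *m Q) = \det M.
Proof.
move=> ab; move: P Q; rewrite ab => P Q PQ.
rewrite !det_mulmx mulrAC -det_mulmx PQ det1 mul1r.
by [].
Qed.

Definition swap_mx m k : 'M[C]_(m + k, k + m) := block_mx 0 1%:M 1%:M 0.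

Lemma swap_mxK m k : swap_mx m k *m swap_mx k m = 1%:M.
Proof.
by rewrite mulmx_block !mulmx0 !mul0mx !mulmx1 !addr0 !add0r -scalar_mx_block.
Qed.

Lemma swap_mx_unitary m k : swap_mx m k \is unitarymx.
Proof.
apply/unitarymxP; rewrite -[RHS](swap_mxK m k); congr (_ *m _).
by rewrite tr_block_mx map_block_mx !trmx0 !trmx1 !map_mx0 !map_mx1.
Qed.

Lemma swap_diag m k (a : 'rV[C]_k) (b : 'rV_m) :
  swap_mx m k *m diag_mx (row_mx a b) *m swap_mx k m = diag_mx (row_mx b a).
Proof.
rewrite !diag_mx_row !mulmx_block !mulmx0 !mul0mx !mulmx1 !mul1mx.
by rewrite !addr0 !add0r.
Qed.

Lemma reorder_states m (s t : seq C) (U : 'M[C]_(size (labels s t) + m)) :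
    U \is unitarymx ->
  exists2 U' : 'M[C]_(m + (size s + size t)), U' \is unitarymx &
    forall z w, \det (U' *m diag_mx (delta_row m _ (size s) z w) -
                      diag_mx (gamma_row m _ (size s) z)) =
      \det (U *m diag_mx (delta_diag (labels s t) m z w) - diag_mx (gamma_diag
        (labels s t) m z 1)).
Proof.
have sl : size (labels s t) = (size s + size t)%N by rewrite size_cat !size_nseq.
rewrite -sl => Uu; set k := size (labels s t) in U Uu *.
exists (swap_mx m k *m U *m swap_mx k m).
  by rewrite !mul_unitarymx ?swap_mx_unitary.
move=> z w.
have nthl (i : 'I_k) : nth false (labels s t) i = (i < size s)%N.
  rewrite nth_cat size_nseq nth_nseq; case: ltnP => // si.
  by rewrite nth_nseq if_same.
have -> : delta_row m k (size s) z w =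
    row_mx (const_mx w) (\row_i if nth false (labels s t) i then z else 1).
  apply/rowP => i; rewrite !mxE; case: splitP => j E; rewrite !mxE ?E //.
  by rewrite nthl ltn_add2l.
have -> : gamma_row m k (size s) z =
    row_mx (const_mx 1) (\row_i if nth false (labels s t) i then 1 else z).
  apply/rowP => i; rewrite !mxE; case: splitP => j E; rewrite !mxE E.
    by rewrite ltn_addr.
  by rewrite nthl ltn_add2l.
have -> : delta_diag (labels s t) m z w =
    row_mx (\row_i if nth false (labels s t) i then z else 1) (const_mx w).
  by apply/rowP => i; rewrite !mxE; case: splitP => j E; rewrite !mxE ?E.
have -> : gamma_diag (labels s t) m z 1 =
    row_mx (\row_i if nth false (labels s t) i then 1 else z) (const_mx 1).
  by apply/rowP => i; rewrite !mxE; case: splitP => j E; rewrite !mxE ?E.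
rewrite -!(swap_diag (m :=
  m)) -!mulmxA (mulmxA (swap_mx k m) (swap_mx m k)) swap_mxK mul1mx.
rewrite -mulmxBr (mulmxA U) -mulmxBl mulmxA.
by rewrite det_conj_rect ?swap_mxK // addnC.
Qed.

End Reindex.

(** * Self-inversive polynomials in two variables *)

Section SelfInversive.
Variable C : numClosedFieldType.
Implicit Types (p : {poly {poly C}}) (z w : C).

Definition primitive_in_z p := forall z, slice p z != 0.

(* Gauss's lemma for [C[z][w]]. *)
Lemma primitive_dvdp p d q (r : {poly {poly C}}) :
  primitive_in_z p -> d != 0 -> d%:P * r = q%:P * p -> d %| q.
Proof.
move=> p_prim; move: {2}(size d) (leqnn (size d)) => k.
elim: k d q r => [|k IH] d q r.
  by rewrite leqn0 size_poly_eq0 => /eqP->; rewrite eqxx.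
have [sd|sd] := leqP (size d) 1.
  move=> _ d0 _; have d1 : size d = 1%N by apply/eqP; rewrite eqn_leq sd size_poly_gt0.
  have /eqp_dvdl -> : d %= 1 by rewrite -size_poly_eq1 d1.
  exact: dvd1p.
move=> sdk d0 E.
have /closed_rootP[a da] : size d != 1%N by rewrite gtn_eqF.
have qa : root q a.
  have := congr1 (fun f => slice f a) E; rewrite /slice !rmorphM /= !map_polyC /=.
  rewrite /horner_eval (rootP da) mul0r => /esym/eqP.
  by rewrite mulf_eq0 polyC_eq0 (negbTE (p_prim a)) orbF.
move: da qa; rewrite -!dvdp_XsubCl => /dvdpP[d1 dE] /dvdpP[q1 qE].
rewrite dE qE dvdp_mul2r ?polyXsubC_eq0 //.
move: d0; rewrite dE mulf_eq0 negb_or => /andP[d10 _].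
apply: (IH d1 q1 r) => //.
  move: sdk; rewrite dE size_Mmonic ?monicXsubC // size_XsubC addn2 /=.
  by [].
have X0 : ('X - a%:P)%:P != 0 :> {poly {poly C}} by rewrite polyC_eq0 polyXsubC_eq0.
by apply: (mulfI X0); rewrite !mulrA -!rmorphM /= ![_ * d1]mulrC ![_ * q1]mulrC -dE -qE.
Qed.

(** If the slice at [z] vanished, [X - z] would divide every coefficient. *)
Lemma no_factor_primitive p : no_factor_in_z_alone p -> p != 0 -> primitive_in_z p.
Proof.
move=> nf p0 z; apply/negP => /eqP pz.
have [r pr] : exists r, p = ('X - z%:P)%:P * r.
  exists (map_poly (fun f => f %/ ('X - z%:P)) p).
  apply/polyP => j; rewrite coefCM coef_map_id0 ?div0p //.
  rewrite mulrC divpK // dvdp_XsubCl; apply/rootP.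
  by rewrite -coef_slice pz coef0.
by have := nf _ _ pr; rewrite size_XsubC.
Qed.

Variables (n m : nat) (p : {poly {poly C}}).
Hypotheses (sizepj : forall j, (size (p`_j)%R <= n.+1)%N) (sizep : size p = m.+1).
Hypothesis p_prim : primitive_in_z p.
Hypothesis p_circle : forall z w, `|z| = 1 -> p.[w, z] = 0 -> `|w| = 1.
Hypothesis size_z : exists j, size (p`_j) = n.+1.

Lemma lead_neq0 : p`_m != 0.
Proof. by have := lead_coef_eq0 p;
  rewrite lead_coefE sizep /= -size_poly_eq0 sizep => ->. Qed.

Lemma slice_roots z : `|z| = 1 -> (p`_m).[z] != 0 ->
  exists rs : seq C, [/\ size rs = m, all (fun a => `|a| == 1) rs &
    slice p z = (p`_m).[z] *: \prod_(a <- rs) ('X - a%:P)].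
Proof.
move=> z1 pm0; have lE : lead_coef (slice p z) = (p`_m).[z].
  by rewrite /slice lead_coef_map_eq lead_coefE sizep.
have sE : size (slice p z) = m.+1.
  by rewrite /slice size_map_poly_id0 // lead_coefE sizep.
have [rs rsE] := closed_field_poly_normal (slice p z).
have l0 : lead_coef (slice p z) != 0 by rewrite lE.
exists rs; split; last by rewrite -lE.
  by move: sE; rewrite rsE size_scale // size_prod_XsubC => -[].
apply/allP => a ars; apply/eqP/(p_circle z1).
rewrite -horner_slice rsE hornerZ horner_prod (big_rem a) //=.
by rewrite hornerXsubC subrr mul0r mulr0.
Qed.

(** The slice has unimodular roots, so its reversal is a constant multiple of it; the constant is
    read off at the extreme coefficients. *)
Lemma conj_coef z j : `|z| = 1 -> (p`_m).[z] != 0 -> (j <= m)%N ->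
  ((p`_(m - j)).[z])^* * (p`_0).[z] = ((p`_m).[z])^* * (p`_j).[z].
Proof.
move=> z1 pm0 jm; have [rs [srs rs1 pE]] := slice_roots z1 pm0.
pose f := \prod_(a <- rs) ('X - a%:P); have sf : size f = m.+1.
  by rewrite size_prod_XsubC srs.
have cE i : (p`_i).[z] = (p`_m).[z] * f`_i by rewrite -coef_slice pE coefZ.
have f0 : f`_0 = \prod_(a <- rs) (- a).
  by rewrite -horner_coef0 horner_prod; apply: eq_bigr => a _;
    rewrite hornerXsubC sub0r.
have rf : revp m f = (\prod_(a <- rs) (- a^*)) *: f.
  apply: revpE => [|w w1]; first by rewrite sf.
  have -> : w ^+ m = \prod_(a <- rs) w.
    by rewrite big_const_seq count_predT iter_mulr_1 srs.
  rewrite hornerZ !horner_prod rmorph_prod -!big_split /=.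
  apply: eq_big_seq => a /(allP rs1) /eqP a1; rewrite hornerXsubC rmorphB.
  rewrite !mulrBr mul_conj_circle // !mulNr opprK [a^* * a]mulrC mul_conj_circle //.
  by rewrite addrC [w * _]mulrC.
have fE : (f`_(m - j))^* * f`_0 = f`_j.
  have := congr1 (fun g : {poly C} => g`_j) rf; rewrite coef_poly ltnS jm coefZ => ->.
  rewrite mulrAC f0 -big_split /= big_seq big1 ?mul1r // => a ars.
  by rewrite mulrNN mulrC mul_conj_circle //; apply/eqP/(allP rs1).
by rewrite (cE (m - j)%N) (cE 0%N) (cE j) rmorphM /= -fE; ring.
Qed.

Lemma coef0_neq0 z : `|z| = 1 -> (p`_0).[z] != 0.
Proof.
move=> z1; apply/negP => /eqP p0z.
have : p.[0, z] = 0 by rewrite -horner_slice horner_coef0 coef_slice.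
by move/(p_circle z1)/eqP; rewrite normr0 eq_sym oner_eq0.
Qed.

(** The reversal [q] of [p] in both variables satisfies [p_0 q = (revp n p_m) p]. Gauss's lemma
    gives [q = h p] with [h] in [z] alone, and the degree in [z] makes [h] constant. *)
Lemma self_inversive : exists2 h : C, h != 0 & revp n p`_m = h *: p`_0.
Proof.
have E j : (j <= m)%N -> revp n p`_(m - j) * p`_0 = revp n p`_m * p`_j.
  (* Zeros of [p_m] on the circle are not excluded yet, so the comparison is made away from them. *)
  move=> jm; apply: (eq_poly_circle_generic lead_neq0) => z z1 pm0.
  by rewrite !hornerM !horner_revp // -!mulrA (conj_coef z1 pm0 jm).
have p00 : p`_0 != 0.
  by apply: contraTneq (coef0_neq0 (normr1 _)) => ->; rewrite horner0 eqxx.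
pose q : {poly {poly C}} := \poly_(j < m.+1) revp n p`_(m - j).
have qE : (p`_0)%:P * q = (revp n p`_m)%:P * p.
  apply/polyP => j; rewrite !coefCM coef_poly ltnS; case: leqP => jm.
    by rewrite mulrC E.
  by rewrite mulr0 [p`_j]nth_default ?mulr0 // sizep.
have /dvdpP[h hE] := primitive_dvdp p_prim p00 qE.
have qE' : q = h%:P * p.
  have P0 : (p`_0)%:P != 0 :> {poly {poly C}} by rewrite polyC_eq0.
  by apply: (mulfI P0); rewrite qE hE [h * _]mulrC polyCM mulrA.
have h0 : h != 0.
  apply: contraTneq lead_neq0 => h0; rewrite negbK -(revpK (sizepj m)) hE h0 mul0r.
  by apply/eqP/revpE => [|z _]; rewrite ?size_poly0 // !horner0 conjC0 mulr0.
have sh : (size h <= 1)%N.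
  have [j sj] := size_z; have pj0 : p`_j != 0 by rewrite -size_poly_eq0 sj.
  have : (size (q`_j)%R <= n.+1)%N.
    by rewrite coef_poly; case: ifP => _; rewrite ?size_revp ?size_poly0.
  by rewrite qE' coefCM size_mul // sj addnS /= -[n.+1]add1n leq_add2r.
exists h`_0; last by rewrite hE {1}(size1_polyC sh) mul_polyC.
by move: h0; rewrite {1}(size1_polyC sh) polyC_eq0.
Qed.

Lemma lead_circle_neq0 z : `|z| = 1 -> (p`_m).[z] != 0.
Proof.
move=> z1; have [h h0 hE] := self_inversive.
have : (revp n p`_m).[z] != 0 by rewrite hE hornerZ mulf_neq0 ?coef0_neq0.
by rewrite horner_revp // mulf_eq0 conjC_eq0 negb_or => /andP[].
Qed.

(** By [self_inversive], [p_m] is a constant times the reversal of [p_0]; hence the number [size s]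
    of its zeros in the disk is [n1]. *)
Lemma lead_factor : exists (s : seq C) (c : C),
  [/\ c != 0, all (fun a => `|a| < 1) s, (size s + size (disk_roots p`_0))%N = n &
    p`_m = c *: (blaschke_num s * blaschke_den (disk_roots p`_0))].
Proof.
have [h h0 hE] := self_inversive.
have p00 : p`_0 != 0.
  by apply: contraTneq (coef0_neq0 (normr1 _)) => ->; rewrite horner0 eqxx.
have [s [c [c0 sD sn rE]]] := revp_factor p00 (sizepj 0) coef0_neq0.
exists s, (h^* * c); split => //; first by rewrite mulf_neq0 ?conjC_eq0.
rewrite -scalerA -rE; apply: eq_poly_circle => z z1.
rewrite hornerZ horner_revp // mulrCA -rmorphM /= -hornerZ -hE horner_revp //.
by rewrite rmorphM rmorphXn /= conjCK mulrA -exprMn mul_conj_circle // expr1n mul1r.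
Qed.

End SelfInversive.

(** * Perturbation to simple roots *)

Section Perturbation.
Variable C : numClosedFieldType.
Implicit Types (z w x : C) (s : seq C).

Lemma horner_deriv_prod (T : eqType) (s : seq T) (F : T -> {poly C}) w :
    (forall a, a \in s -> (F a).[w] != 0) ->
  (\prod_(a <- s) F a)^`().[w] =
  (\prod_(a <- s) F a).[w] * \sum_(a <- s) (F a)^`().[w] / (F a).[w].
Proof.
elim: s => [|a s IH] H; first by rewrite !big_nil mulr0 derivC horner0.
rewrite !big_cons derivM hornerD !hornerM IH; last first.
  by move=> b bs; rewrite H // in_cons bs orbT.
have Fa : (F a).[w] != 0 by rewrite H // mem_head.
by rewrite mulrDr; congr (_ + _); [field | ring].
Qed.

(* Nuij-type perturbation: the coefficient of [w^j] is scaled so that, up to a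
   constant, [p(z, w)] becomes [p(z, x w) + x^m p(z, w / x)]; the extreme
   coefficients are unchanged. *)
Definition nuij_coef m x j : C := (x ^+ j + x ^+ (m - j)) / (1 + x ^+ m).
Definition nuij m x (p : {poly {poly C}}) : {poly {poly C}} :=
  \poly_(j < m.+1) (nuij_coef m x j *: p`_j).

Section Circle.
Variables (x : C) (s : seq C).
Hypotheses (x01 : 0 < x < 1) (s1 : forall a, a \in s -> `|a| = 1) (s0 : s != [::]).

Let X : {poly C} := \prod_(a <- s) (x *: 'X - a%:P).
Let Y : {poly C} := \prod_(a <- s) ('X - (x * a)%:P).

Let x_conj : x^* = x.
Proof. by rewrite geC0_conj // ltW //; case/andP: x01. Qed.

Let hX w : X.[w] = \prod_(a <- s) (x * w - a).
Proof. by rewrite horner_prod; apply: eq_bigr => a _; rewrite !hornerE. Qed.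

Let hY w : Y.[w] = \prod_(a <- s) (w - x * a).
Proof. by rewrite horner_prod; apply: eq_bigr => a _; rewrite !hornerE. Qed.

Lemma norm_nuij_factor w a : `|a| = 1 ->
  `|x * w - a| ^+ 2 - `|w - x * a| ^+ 2 = (1 - x ^+ 2) * (1 - `|w| ^+ 2).
Proof.
move=> a1; have aa := mul_conj_circle a1.
by rewrite !normCK !rmorphB !rmorphM /= x_conj; ring: aa.
Qed.

Lemma ltr_prod_seq (f g : C -> C) : (forall a, a \in s -> 0 <= f a < g a) ->
  \prod_(a <- s) f a < \prod_(a <- s) g a.
Proof.
move=> fg; rewrite !big_seq; apply: ltr_prod => [|a /fg //].
by apply/hasP; case: s s0 => // a r _; exists a; rewrite mem_head.
Qed.

(** Inside the disk each factor of [X] exceeds in modulus the matching factor of [Y], and outside it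
    is smaller, so [|X| = |Y|] is possible only on the circle. *)
Lemma nuij_root_norm w : X.[w] + Y.[w] = 0 -> `|w| = 1.
Proof.
move=> /eqP; rewrite addr_eq0 hX hY => /eqP /(congr1 Num.norm);
  rewrite normrN !normr_prod => XY.
have /andP[x0 x1] := x01.
have cx : 0 < 1 - x ^+ 2 by rewrite subr_gt0 expr_lt1 // ltW.
have [w1|w1|//] := real_ltgtP (ger0_real (normr_ge0 w)) (ger0_real (@ler01 C)).
- have : \prod_(a <- s) `|w - x * a| < \prod_(a <- s) `|x * w - a|;
  last by rewrite XY ltxx.
  apply: ltr_prod_seq => a /s1 a1; rewrite normr_ge0 /=.
  rewrite -ltr_sqr ?nnegrE // -subr_gt0 norm_nuij_factor // mulr_gt0 //.
  by rewrite subr_gt0 expr_lt1.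
- have : \prod_(a <- s) `|x * w - a| < \prod_(a <- s) `|w - x * a|;
  last by rewrite XY ltxx.
  apply: ltr_prod_seq => a /s1 a1; rewrite normr_ge0 /=.
  rewrite -ltr_sqr ?nnegrE // -subr_lt0 norm_nuij_factor // pmulr_rlt0 //.
  by rewrite subr_lt0 exprn_egt1.
Qed.

Lemma nuij_factor_neq0 w a : `|w| = 1 -> `|a| = 1 ->
  (x * w - a != 0) && (w - x * a != 0).
Proof.
have /andP[x0 x1] := x01 => w1 a1.
rewrite !subr_eq0; apply/andP; split; apply/negP => /eqP /(congr1 Num.norm).
  by rewrite normrM w1 a1 mulr1 gtr0_norm // => E; rewrite E ltxx in x1.
by rewrite normrM w1 a1 mulr1 gtr0_norm // => E; rewrite -E ltxx in x1.
Qed.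

(** The difference of the logarithmic derivatives of two matching factors is a positive multiple of
    [- 1 / w], whatever [a] is. *)
Lemma nuij_factor_log w a : `|w| = 1 -> `|a| = 1 ->
  x / (x * w - a) - (w - x * a)^-1 = - (1 - x ^+ 2) / w * (`|w - x * a| ^+ 2)^-1.
Proof.
move=> w1 a1; have /andP[n1 n2] := nuij_factor_neq0 w1 a1.
have ww := mul_conj_circle w1; have aa := mul_conj_circle a1.
have w0 := circle_neq0 w1; have a0 := circle_neq0 a1.
have E : (w - x * a)^* * (w * a) = - (x * w - a).
  by rewrite rmorphB rmorphM /= x_conj; ring: ww aa.
have -> : `|w - x * a| ^+ 2 = - (w - x * a) * (x * w - a) / (w * a).
  rewrite normCK; apply: (mulIf (mulf_neq0 w0 a0)).
  by rewrite -[LHS]mulrA E divfK ?mulf_neq0 // mulrN mulNr.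
by field; rewrite n1 n2 w0 a0.
Qed.

(* At a root [X = - Y], so that the derivative is [X] times a sum of numbers which
   all lie on the open half-line spanned by [- 1 / w]. *)
Lemma nuij_root_simple w : `|w| = 1 -> X.[w] + Y.[w] = 0 -> X^`().[w] + Y^`().[w] != 0.
Proof.
move=> w1 /eqP; rewrite addr_eq0 => /eqP XY; have w0 := circle_neq0 w1.
have n0 a : a \in s -> (x * w - a != 0) && (w - x * a != 0).
  by move=> /s1; exact: nuij_factor_neq0.
rewrite !horner_deriv_prod; first last.
- by move=> a /n0 /andP[]; rewrite !hornerE.
- by move=> a /n0 /andP[_]; rewrite !hornerE.
rewrite -/X -/Y XY mulNr addrC -mulrBr mulf_neq0 //.
  rewrite -oppr_eq0 -XY hX prodf_seq_neq0; apply/allP => a /n0 /andP[].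
  by [].
rewrite -oppr_eq0 opprB -sumrB.
rewrite (eq_big_seq (fun a => - (1 - x ^+ 2) / w * (`|w - x * a| ^+ 2)^-1)); last first.
  move=> a /s1 a1; rewrite -nuij_factor_log //.
  have -> : (x *: 'X - a%:P)^`() = x%:P
    by rewrite derivB derivZ derivX derivC subr0 alg_polyC.
  by rewrite derivXsubC !hornerE ?mul1r.
have /andP[x0 x1] := x01.
rewrite -mulr_sumr mulf_neq0 //.
  rewrite mulf_neq0 ?invr_neq0 // oppr_eq0 subr_eq0 eq_sym lt_eqF //.
  by rewrite expr_lt1 // ltW.
case: s s0 n0 => // a r _ n0; rewrite big_cons gt_eqF // ltr_wpDr ?sumr_ge0 //.
  by move=> i _; rewrite invr_ge0 exprn_ge0.
rewrite invr_gt0 exprn_gt0 // normr_gt0.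
by case/andP: (n0 a (mem_head _ _)).
Qed.

End Circle.

Lemma nuij_coef0 m x : 0 < x -> nuij_coef m x 0 = 1.
Proof.
by move=> x0; rewrite /nuij_coef expr0 subn0 divff // gt_eqF // addr_gt0 // exprn_gt0.
Qed.

Lemma nuij_coef_max m x : 0 < x -> nuij_coef m x m = 1.
Proof.
by move=> x0; rewrite /nuij_coef subnn expr0 addrC divff // gt_eqF // addr_gt0 //
  exprn_gt0.
Qed.

Lemma nuij_simple_on_circle k x (p : {poly {poly C}}) : 0 < x < 1 ->
    (forall z, `|z| = 1 -> (p`_k.+1).[z] != 0 /\
      exists s : seq C, [/\ size s = k.+1, all (fun a => `|a| == 1) s &
        slice p z = (p`_k.+1).[z] *: \prod_(a <- s) ('X - a%:P)]) ->
  simple_on_circle k (nuij k.+1 x p).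
Proof.
set m := k.+1 => x01 H; rewrite /simple_on_circle -/m => z z1.
have [pm0 [s [ss s1 pE]]] := H z z1.
have /andP[x0 x1] := x01; have xn0 : x != 0 by rewrite gt_eqF.
have sn : s != [::] by rewrite -size_eq0 ss.
have {}s1 a : a \in s -> `|a| = 1 by move/(allP s1)/eqP.
have d0 : 1 + x ^+ m != 0 by rewrite gt_eqF // addr_gt0 // exprn_gt0.
set c := (p`_m).[z] in pm0 pE.
have cE : ((nuij m x p)`_m).[z] = c.
  by rewrite coef_poly ltnSn nuij_coef_max // scale1r.
rewrite cE; set g := slice _ z.
pose f : {poly C} := \prod_(a <- s) ('X - a%:P).
pose X : {poly C} := \prod_(a <- s) (x *: 'X - a%:P).
pose Y : {poly C} := \prod_(a <- s) ('X - (x * a)%:P).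
have sf : (size f <= m.+1)%N by rewrite size_prod_XsubC ss.
have sg : (size g <= m.+1)%N by apply: (leq_trans (size_poly _ _)); exact: size_poly.
have XE w : X.[w] = f.[x * w].
  by rewrite !horner_prod; apply: eq_bigr => a _; rewrite !hornerE.
have YE w : Y.[w] = x ^+ m * f.[w / x].
  have -> : x ^+ m = \prod_(a <- s) x
    by rewrite big_const_seq count_predT iter_mulr_1 ss.
  rewrite !horner_prod -big_split /=; apply: eq_bigr => a _.
  by rewrite !hornerE mulrBr mulrCA divff // mulr1.
(* With [f] the monic slice, [X = f(x w)] and [Y = x^m f(w / x)], so the perturbed slice is [X + Y]
   up to a constant. *)
have gE : g = (c / (1 + x ^+ m)) *: (X + Y).
  apply: eq_poly_circle => w _; rewrite hornerZ hornerD XE YE.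
  rewrite (horner_coef_wide _ sg) !(horner_coef_wide _ sf) mulr_sumr -big_split
    mulr_sumr /=.
  apply: eq_bigr => j _;
    rewrite coef_slice coef_poly ltn_ord hornerZ -coef_slice pE coefZ -/f.
  rewrite /nuij_coef !exprMn exprVn.
  have jm : (j <= m)%N by rewrite -ltnS.
  rewrite expfB_cond ?(negbTE xn0) //.
  by field; rewrite d0 expf_neq0.
have k0 : c / (1 + x ^+ m) != 0 by rewrite mulf_neq0 ?invr_neq0.
have gm : g`_m = c by rewrite coef_slice cE.
have sgE : size g = m.+1.
  by apply/eqP; rewrite eqn_leq sg ltnNge;
    apply: contra pm0 => /leq_sizeP/(_ m (leqnn m)) E; rewrite -gm E.
have lg : lead_coef g = c by rewrite lead_coefE sgE.
have g0 : g != 0 by rewrite -lead_coef_eq0 lg.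
have [r rE] := closed_field_poly_normal g; rewrite lg in rE.
have sr : size r = m by move: sgE; rewrite rE size_scale // size_prod_XsubC => -[].
have rootXY a : root g a -> X.[a] + Y.[a] = 0.
  by rewrite /root gE hornerZ mulf_eq0 (negbTE k0) hornerD => /eqP.
have rg a : a \in r -> root g a.
  by move=> ar; rewrite rE rootZ // root_prod_XsubC.
have r1 a : a \in r -> `|a| = 1 by move=> /rg/rootXY; exact: nuij_root_norm.
have ur : uniq r.
  rewrite -separable_prod_XsubC.
  (* A multiple root would be a root of the derivative too, against [nuij_root_simple]. *)
  have cop : coprimep g g^`().
    apply: coprimep_no_common_root => // a ga.
    have a1 : `|a| = 1 by apply: nuij_root_norm (rootXY a ga).
    rewrite /root {1}gE derivZ derivD hornerZ mulf_neq0 // hornerD.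
    exact: nuij_root_simple a1 (rootXY a ga).
  by move: cop; rewrite rE derivZ coprimepZl // coprimepZr // separable_poly.unlock.
exists (fun i => nth 0 r i); split => //.
- by move=> i j /eqP; rewrite nth_uniq ?sr // => /eqP/val_inj.
- by move=> i; rewrite r1 // mem_nth ?sr.
- by rewrite {1}rE (big_nth 0) big_mkord sr.
Qed.

End Perturbation.

(** * Limits along an ultrafilter *)

Section UltraLimit.
Variables (R : realType) (F : set_system nat).
Hypothesis FU : UltraFilter F.
Local Notation C := R[i].
Implicit Types (u v : nat -> C) (a b l : C).

(** Along an ultrafilter every bounded sequence converges, so that all matrix entries and constants
    have limits at once, without extracting subsequences. *)
Definition ulim u l :=
  ((fun k => complex.Re (u k)) @ F --> complex.Re l)%classic /\
  ((fun k => complex.Im (u k)) @ F --> complex.Im l)%classic.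

Lemma ulim_cst a : ulim (fun=> a) a.
Proof. by split; exact: cvg_cst. Qed.

Lemma ulimD u v a b : ulim u a -> ulim v b -> ulim (fun k => u k + v k) (a + b).
Proof.
move=> [u1 u2] [v1 v2]; split.
  have E x y : complex.Re (x + y : C) = complex.Re x + complex.Re y
    by case: x y => ? ? [].
  by rewrite E; under eq_fun do rewrite E; exact: cvgD.
have E x y : complex.Im (x + y : C) = complex.Im x + complex.Im y
  by case: x y => ? ? [].
by rewrite E; under eq_fun do rewrite E; exact: cvgD.
Qed.

Lemma ulimM u v a b : ulim u a -> ulim v b -> ulim (fun k => u k * v k) (a * b).
Proof.
move=> [u1 u2] [v1 v2]; split.
  have E x y : complex.Re (x * y : C) =
      complex.Re x * complex.Re y - complex.Im x * complex.Im y by case: x y => ? ? [].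
  by rewrite E; under eq_fun do rewrite E; apply: cvgB; exact: cvgM.
have E x y : complex.Im (x * y : C) =
    complex.Re x * complex.Im y + complex.Im x * complex.Re y by case: x y => ? ? [].
by rewrite E; under eq_fun do rewrite E; apply: cvgD; exact: cvgM.
Qed.

Lemma ulim_conj u a : ulim u a -> ulim (fun k => (u k)^*) a^*.
Proof.
move=> [u1 u2]; split.
  have E (x : C) : complex.Re x^* = complex.Re x by case: x.
  by rewrite E; under eq_fun do rewrite E.
have E (x : C) : complex.Im x^* = - complex.Im x by case: x.
by rewrite E; under eq_fun do rewrite E; exact: cvgN.
Qed.

Lemma ulim_sum (I : Type) (r : seq I) (P : pred I) (u : I -> nat -> C) (l : I -> C) :
  (forall i, ulim (u i) (l i)) ->
  ulim (fun k => \sum_(i <- r | P i) u i k) (\sum_(i <- r | P i) l i).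
Proof.
move=> H; elim: r => [|i r IH].
  by rewrite big_nil; under eq_fun do rewrite big_nil; exact: ulim_cst.
rewrite big_cons; under eq_fun do rewrite big_cons.
by case: (P i) => //; exact: ulimD.
Qed.

Lemma ulim_prod (I : Type) (r : seq I) (P : pred I) (u : I -> nat -> C) (l : I -> C) :
  (forall i, ulim (u i) (l i)) ->
  ulim (fun k => \prod_(i <- r | P i) u i k) (\prod_(i <- r | P i) l i).
Proof.
move=> H; elim: r => [|i r IH].
  by rewrite big_nil; under eq_fun do rewrite big_nil; exact: ulim_cst.
rewrite big_cons; under eq_fun do rewrite big_cons.
by case: (P i) => //; exact: ulimM.
Qed.

Lemma ulimX u a n : ulim u a -> ulim (fun k => u k ^+ n) (a ^+ n).
Proof.
move=> ua; elim: n => [|n IH].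
  by rewrite expr0; under eq_fun do rewrite expr0; exact: ulim_cst.
by rewrite exprS; under eq_fun do rewrite exprS; exact: ulimM.
Qed.

Lemma ulim_unique u a b : ulim u a -> ulim u b -> a = b.
Proof.
case: a b => [a1 a2] [b1 b2] [/= ua1 ua2] [/= ub1 ub2].
by rewrite (cvg_unique (@Rhausdorff R) ua1 ub1) (cvg_unique (@Rhausdorff R) ua2 ub2).
Qed.

(** Compactness gives a cluster point, and along an ultrafilter a cluster point is a limit. *)
Lemma ultra_bounded_cvg (x : nat -> R) : (forall k, -1 <= x k <= 1) ->
  exists l : R, (x @ F --> l)%classic.
Proof.
move=> xb; have FI : F (x @^-1` `[(-1 : R), 1])%classic.
  apply: filterE => k.
  by rewrite /= in_itv /= xb.
have [l [_ lcl]] := @segment_compact R (-1) 1 (x @ F)%classic _ FI.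
exists l => A lA; have [//|FA] := in_ultra_setVsetC (x @^-1` A)%classic FU.
by have [y [nAy Ay]] := lcl (~` A)%classic A FA lA.
Qed.

Lemma ulim_exists u : (forall k, `|u k| <= 1) -> exists l, ulim u l.
Proof.
move=> ub.
have bound (k : nat) : complex.Re (u k) ^+ 2 + complex.Im (u k) ^+ 2 <= 1.
  have : `|u k| ^+ 2 <= 1 by rewrite expr_le1.
  by rewrite -add_Re2_Im2 -[1]/(1%:C)%C lecR.
have sqb (a b : R) : a ^+ 2 + b ^+ 2 <= 1 -> -1 <= a <= 1.
  move=> ab; rewrite -ler_norml -(ler_sqr (normr_ge0 a)) ?nnegrE ?ler01 //.
  by rewrite expr1n real_normK ?num_real // (le_trans _ ab) // lerDl sqr_ge0.
have [a ua] := ultra_bounded_cvg (fun k => sqb _ _ (bound k)).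
have bound' k : complex.Im (u k) ^+ 2 + complex.Re (u k) ^+ 2 <= 1 by rewrite addrC.
have [b ub'] := ultra_bounded_cvg (fun k => sqb _ _ (bound' k)).
by exists (Complex a b).
Qed.

Lemma ulim_det n (u : nat -> 'M[C]_n) (l : 'M[C]_n) :
  (forall i j, ulim (fun k => u k i j) (l i j)) ->
  ulim (fun k => \det (u k)) (\det l).
Proof.
move=> ul; apply: ulim_sum => s; apply: ulimM; first exact: ulim_cst.
by apply: ulim_prod => i.
Qed.

Lemma ulim_mulmx m n p (u : nat -> 'M[C]_(m, n)) (l : 'M[C]_(m, n))
    (v : nat -> 'M[C]_(n, p)) (l' : 'M[C]_(n, p)) :
  (forall i j, ulim (fun k => u k i j) (l i j)) ->
  (forall i j, ulim (fun k => v k i j) (l' i j)) ->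
  forall i j, ulim (fun k => (u k *m v k) i j) ((l *m l') i j).
Proof.
move=> ul vl i j; rewrite mxE; under eq_fun do rewrite mxE.
by apply: ulim_sum => h; exact: ulimM.
Qed.

(** The rows are unit vectors, which bounds the entries by 1, and the equation [U U^* = 1] passes to
    the limit. *)
Lemma ulim_unitary n (u : nat -> 'M[C]_n) : (forall k, u k \is unitarymx) ->
  exists2 l : 'M[C]_n, l \is unitarymx & forall i j, ulim (fun k => u k i j) (l i j).
Proof.
move=> uU.
have entry k i j : `|u k i j| <= 1.
  have /unitarymxP/matrixP/(_ i i) := uU k; rewrite !mxE eqxx (bigD1 j) //=.
  rewrite !mxE -normCK => E.
  suff : `|u k i j| ^+ 2 <= 1 by rewrite expr_le1.
  apply: (le_trans (y := `|u k i j| ^+ 2 + \sum_(h < n | h != j) u k i h * (u k)^t* h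
    i)); last by rewrite E.
  rewrite lerDl sumr_ge0 // => h _.
  by rewrite !mxE -normCK exprn_ge0.
have /choice[f fE] : forall ij : 'I_n * 'I_n, exists l, ulim (fun k => u k ij.1 ij.2) l.
  by move=> ij; apply: ulim_exists => k.
pose l : 'M[C]_n := \matrix_(i, j) f (i, j).
have ul i j : ulim (fun k => u k i j) (l i j) by rewrite mxE; exact: (fE (i, j)).
exists l => //; apply/unitarymxP/matrixP => i j.
apply: (@ulim_unique (fun k => (u k *m (u k)^t*) i j)).
  apply: ulim_mulmx => // i' j'; rewrite 2!mxE; under eq_fun do rewrite 2!mxE.
  exact: ulim_conj.
by under eq_fun => k do rewrite (unitarymxP (uU k)); exact: ulim_cst.
Qed.

End UltraLimit.

(** * Passage to the limit and conclusion *)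

Section Statement.
Variable R : realType.
Local Notation C := R[i].

Lemma eq_bipoly_circle (P Q : {poly {poly C}}) :
  (forall z w : C, `|z| = 1 -> P.[w, z] = Q.[w, z]) -> P = Q.
Proof.
move=> H; apply/polyP => j; apply: eq_poly_circle => z z1; rewrite -!coef_slice.
by have -> : slice P z = slice Q z by apply: eq_poly_circle => w _;
  rewrite !horner_slice H.
Qed.

Lemma horner_det_pencil m n n1 (U : 'M[C]_(m + n)) z w :
  (\det (const_poly_mx U *m Delta C m n n1 - Gamma C m n n1)).[w, z] =
  \det (U *m diag_mx (delta_row m n n1 z w) - diag_mx (gamma_row m n n1 z)).
Proof.
have E M : (\det M).[w%:P] = \det (map_mx (horner_eval w%:P) M) :> {poly C}
  by rewrite det_map_mx.
rewrite E -det_evalmx; congr (\det _);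
  rewrite /evalmx !map_mxB !map_mxM /Delta /Gamma !map_diag_mx;
    congr (_ *m diag_mx _ - diag_mx _).
- by apply/matrixP => i j; rewrite !mxE /= /horner_eval !hornerC.
- apply/rowP => i; rewrite !mxE /= /horner_eval.
  by case: ifP => _; last case: ifP => _; rewrite !(hornerX, hornerC).
- apply/rowP => i; rewrite !mxE /= /horner_eval.
  by case: ifP => _; rewrite !(hornerX, hornerC).
Qed.

Lemma bidegree_size (n m : nat) (p : {poly {poly C}}) : has_bidegree p n m ->
  (forall j, (size (p`_j)%R <= n.+1)%N) /\ exists j, size (p`_j) = n.+1.
Proof.
move=> [sY sp]; split => [j|]; first by rewrite -sY max_size_coefXY.
have [|j jE] := @bigop.eq_bigmax 'I_(size p) (fun j => size (p`_j)).
  by rewrite card_ord sp.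
by exists j; rewrite -jE -/(sizeY p) sY.
Qed.

(** Without [w], [p] itself is a factor in [z] alone. *)
Lemma bidegree_no_w n (p : {poly {poly C}}) :
  has_bidegree p n 0 -> no_factor_in_z_alone p -> n = 0%N.
Proof.
move=> pd nf; have [_ [j sj]] := bidegree_size pd; have [sY sp] := pd.
have pE : p = (p`_0)%:P * 1 by rewrite mulr1 {1}(size1_polyC (eq_leq sp)).
case: j sj => [|j] sj; last by move: sj; rewrite nth_default ?sp // size_poly0.
by have := nf _ _ pE; rewrite sj; case: n {sj pd sY}.
Qed.

Lemma nuij_horner m (x : C) (p : {poly {poly C}}) z w : 0 < x -> (size p <= m.+1)%N ->
  (1 + x ^+ m) * (nuij m x p).[w, z] =
  \sum_(j < m.+1) (x ^+ j + x ^+ (m - j)) * ((p`_j).[z] * w ^+ j).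
Proof.
move=> x0 sp; have d0 : 1 + x ^+ m != 0 by rewrite gt_eqF // addr_gt0 // exprn_gt0.
have sg : (size (slice (nuij m x p) z) <= m.+1)%N.
  by apply: (leq_trans (size_poly _ _)); exact: size_poly.
rewrite -horner_slice (horner_coef_wide _ sg) mulr_sumr; apply: eq_bigr => j _.
rewrite coef_slice coef_poly ltn_ord hornerZ /nuij_coef.
by field.
Qed.

Lemma simple_det_reordered k n (q : {poly {poly C}}) (s : seq C) (c : C) :
    simple_on_circle k q -> c != 0 -> all (fun a => `|a| < 1) s ->
    (size s + size (disk_roots q`_0))%N = n ->
    q`_k.+1 = c *: (blaschke_num s * blaschke_den (disk_roots q`_0)) ->
  exists (U : 'M[C]_(k.+1 + n)) (e : C), [/\ U \is unitarymx, `|e| = 1 &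
    forall z w, `|z| = 1 ->
    c * \det (U *m diag_mx (delta_row k.+1 n (size s) z w) -
      diag_mx (gamma_row k.+1 n (size s) z)) = e * q.[w, z]].
Proof.
move=> qs c0 sD <- qE; have [U [e [Uu e1 H]]] := simple_det_realization qs c0 sD qE.
have [U' U'u U'E] := reorder_states Uu.
by exists U', e; split => // z w z1; rewrite U'E H.
Qed.

(** The formula holds for the perturbations [nuij m x p], whose roots over the circle are simple,
    and passes to the limit as [x] tends to 1. *)
Lemma det_representation k n (p : {poly {poly C}}) :
    has_bidegree p n k.+1 -> no_factor_in_z_alone p ->
    (forall z w : C, `|z| = 1 -> p.[w, z] = 0 -> `|w| = 1) ->
  exists (U : 'M[C]_(k.+1 + n)) (c : C), U \is unitarymx /\
    forall z w : C, `|z| = 1 ->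
    p.[w, z] = c * \det (U *m diag_mx (delta_row k.+1 n (n - size (disk_roots p`_0))
      z w) -
      diag_mx (gamma_row k.+1 n (n - size (disk_roots p`_0)) z)).
Proof.
set m := k.+1 => pd nf pT; have [sizepj size_z] := bidegree_size pd.
have [sY sp] := pd; have p0 : p != 0 by rewrite -size_poly_eq0 sp.
have prim := no_factor_primitive nf p0.
have [s [c [c0 sD sn pmE]]] := lead_factor sizepj sp prim pT size_z.
have pm0 := lead_circle_neq0 sizepj sp prim pT size_z.
set t := disk_roots _ in sn pmE *.
have -> : (n - size t)%N = size s by rewrite -sn addnK.
(* This is [1 - 1 / (2 (j + 1))]; the factor 2 keeps [xr 0] positive. *)
pose xr (j : nat) : R := 1 - harmonic j / 2%:R.
pose x (j : nat) : C := (xr j)%:C%C.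
have x01 j : 0 < x j < 1.
  rewrite -[0]/(0%:C)%C -[1 in X in _ && X]/(1%:C)%C !ltcR /xr subr_gt0 ltrBlDr ltrDl.
  have h0 : 0 < harmonic j :> R by rewrite /harmonic /= invr_gt0 ltr0n.
  have h1 : harmonic j <= 1 :> R by rewrite /harmonic /= invf_le1 ?ltr0n // ler1n.
  rewrite divr_gt0 ?ltr0n // andbT ltr_pdivrMr ?ltr0n // mul1r.
  by rewrite (le_lt_trans h1) // ltr1n.
have x0 j : 0 < x j by case/andP: (x01 j).
have rep j : exists Ue : 'M[C]_(m + n) * C, [/\ Ue.1 \is unitarymx, `|Ue.2| = 1 &
    forall z w, `|z| = 1 ->
    c * \det (Ue.1 *m diag_mx (delta_row m n (size s) z w) - diag_mx (gamma_row m n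
      (size s) z)) =
    Ue.2 * (nuij m (x j) p).[w, z]].
  have sc : simple_on_circle k (nuij m (x j) p).
    apply: nuij_simple_on_circle => // z z1; split; first exact: pm0.
    exact: (slice_roots sp pT z1 (pm0 _ z1)).
  (* The extreme coefficients do not change, so [s] and [c] serve for all [j]. *)
  have q0 : (nuij m (x j) p)`_0 = p`_0.
    by rewrite coef_poly /= nuij_coef0 // scale1r.
  have qm : (nuij m (x j) p)`_m =
    c *: (blaschke_num s * blaschke_den (disk_roots (nuij m (x j) p)`_0)).
    by rewrite q0 -pmE coef_poly ltnSn nuij_coef_max // scale1r.
  have sn' : (size s + size (disk_roots (nuij m (x j) p)`_0))%N = n by rewrite q0.
  have [U [e [Uu e1 H]]] := simple_det_reordered sc c0 sD sn' qm.
  by exists (U, e).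
have [Ue UeP] := choice rep.
have [F [FU sF]] := ultraFilterLemma (@eventually_filter).
have ux : ulim F x 1.
  split; last exact: cvg_cst.
  have xr1 : (xr @ \oo --> (1 : R))%classic.
    rewrite -[X in (_ --> X)%classic](subr0 1) -[X in 1 - X](mul0r 2%:R^-1).
    by apply: cvgB; [exact: cvg_cst | apply: cvgMl; exact: cvg_harmonic].
  by apply: cvg_trans xr1 => A; exact: sF.
have [U Uu UE] : exists2 U : 'M[C]_(m + n), U \is unitarymx &
    forall i j, ulim F (fun h => (Ue h).1 i j) (U i j).
  by apply: ulim_unitary => h; case: (UeP h).
have [e eE] : exists e, ulim F (fun h => (Ue h).2) e.
  by apply: ulim_exists => h; case: (UeP h) => _ ->.
(* The limit of the unimodular constants is unimodular, which permits the division by [e]. *)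
have ee : e * e^* = 1.
  apply: (ulim_unique FU (u := fun h => (Ue h).2 * ((Ue h).2)^*)).
    by apply: ulimM => //; exact: ulim_conj.
  under eq_fun => h do (case: (UeP h) => _ /mul_conj_circle -> _).
  exact: ulim_cst.
have e0 : e != 0 by apply: contra_eq_neq ee => ->; rewrite mul0r eq_sym oner_eq0.
exists U, (c / e); split => // z w z1.
pose D (V : 'M[C]_(m + n)) := \det (V *m diag_mx (delta_row m n (size s) z w) -
  diag_mx (gamma_row m n (size s) z)).
(* [S (x h)] is [1 + x h ^+ m] times the perturbed polynomial at [(z, w)]; being polynomial in [y],
   it has the limit [S 1], twice the value of [p]. *)
pose S (y : C) := \sum_(j < m.+1) (y ^+ j + y ^+ (m - j)) * ((p`_j).[z] * w ^+ j).
have H h : (1 + x h ^+ m) * (c * D (Ue h).1) = (Ue h).2 * S (x h).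
  case: (UeP h) => _ _ ->; rewrite // mulrCA /S -nuij_horner //.
  by rewrite sp.
have limD : ulim F (fun h => D (Ue h).1) (D U).
  apply: ulim_det => i j; rewrite mul_mx_diag !mxE.
  under eq_fun do rewrite mul_mx_diag !mxE.
  by apply: ulimD; [apply: ulimM => // |]; exact: ulim_cst.
have limS : ulim F (fun h => S (x h)) (S 1).
  apply: ulim_sum => j; apply: ulimM; last exact: ulim_cst.
  by apply: ulimD; exact: ulimX.
have E : (1 + 1 ^+ m) * (c * D U) = e * S 1.
  apply: (ulim_unique FU (u := fun h => (1 + x h ^+ m) * (c * D (Ue h).1))).
    apply: ulimM; first by apply: ulimD; [exact: ulim_cst | exact: ulimX].
    by apply: ulimM => //; exact: ulim_cst.
  by under eq_fun do rewrite H; exact: ulimM.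
have S1 : S 1 = 2%:R * p.[w, z].
  rewrite -horner_slice (@horner_coef_wide _ m.+1); last first.
    by rewrite -sp; exact: size_poly.
  rewrite mulr_sumr; apply: eq_bigr => j _; rewrite !expr1n coef_slice.
  by rewrite -mulr2n.
have n2 : 2%:R != 0 :> C by rewrite pnatr_eq0.
apply: (mulfI e0); apply: (mulfI n2); rewrite mulrCA -S1 -E expr1n -/(D U).
by rewrite -mulr2n; field.
Qed.

End Statement.

Local Open Scope complex_scope.

Theorem theorem10p5 (R : realType) (n m : nat) (p : {poly {poly R[i]}})
  (p_deg : has_bidegree p n m)
  (p_nofactor : no_factor_in_z_alone p)
  (p_zeros : forall z w : R[i], peval p z w = 0 ->
     `|z| < 1 \/ (`|z| = 1 /\ `|w| = 1) \/ 1 < `|z|) :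
  let n2 := nb_zeros_disk p.[0] in
  let n1 := (n - n2)%N in
  exists (U : 'M[R[i]]_(m + n)) (c : R[i]),
    U \is unitarymx /\
    p = c%:P%:P * \det (const_poly_mx U *m Delta R[i] m n n1 - Gamma R[i] m n n1).
Proof.
move=> n2 n1.
have pT (z w : R[i]) : `|z| = 1 -> p.[w, z] = 0 -> `|w| = 1.
  by move=> z1 /p_zeros; rewrite z1 !ltxx => -[//|[[]|]].
have n2E : n2 = size (disk_roots p`_0) by rewrite /n2 horner_coef0 size_filter.
(* For [m = 0] the polynomial is constant and the determinant is that of an empty matrix. *)
case: m p_deg @n1 => [|k] p_deg n1.
  have n0 := bidegree_no_w p_deg p_nofactor.
  move: p_deg @n1; rewrite n0 => p_deg n1.
  have [sizepj _] := bidegree_size p_deg; have [_ sp] := p_deg.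
  exists 1%:M, (p`_0)`_0; split; first by apply/unitarymxP/matrixP => -[].
  by rewrite det_mx00 mulr1 -(size1_polyC (sizepj 0)) -(size1_polyC (eq_leq sp)).
have [U [c [Uu H]]] := det_representation p_deg p_nofactor pT.
exists U, c; split => //; apply: eq_bipoly_circle => z w z1.
by rewrite H // -n2E -/n1 hornerM !hornerC hornerM hornerC horner_det_pencil.
Qed.
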